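(* Consider $\min_{x\in\mathbb{R}^d} f(x)$ with $f=\frac1n\sum_{i=1}^n f_i$ and $f_i(x)=\mathbb{E}_{\xi_i\sim\mathcal{D}_i}[f_i(x;\xi_i)]$. Assume: (i) every compressor $\mathcal{C}_i^t$ is $\alpha$-contractive with a common $\alpha\in(0,1]$; (ii) $f^{\inf}:=\inf_{x\in\mathbb{R}^d} f(x)>-\infty$; (iii) for each $i$ there is $L_{\mathrm{ms},i}>0$ with $\mathbb{E}_{\xi_i}\|\nabla f_i(x;\xi_i)-\nabla f_i(y;\xi_i)\|^2\le L_{\mathrm{ms},i}^2\|x-y\|^2$ for all $x,y\in\mathbb{R}^d$; (iv) there is $L>0$ with $\|\nabla f(x)-\nabla f(y)\|\le L\|x-y\|$ for all $x,y\in\mathbb{R}^d$; (v) for all $i$ and all $x\in\mathbb{R}^d$: $\mathbb{E}[\nabla f_i(x;\xi_i)]=\nabla f_i(x)$ and $\mathbb{E}\|\nabla f_i(x;\xi_i)-\nabla f_i(x)\|^2\le\sigma_g^2$, and also $\mathbb{E}[\nabla^2 f_i(x;\xi_i)]=\nabla^2 f_i(x)$ and $\mathbb{E}\|\nabla^2 f_i(x;\xi_i)-\nabla^2 f_i(x)\|^2\le\sigma_h^2$. Let $\gamma_0>0$ and $$\eta_t=\left(\frac{2}{t+2}\right)^{2/3},\qquad \gamma_t=\gamma_0\left(\frac{2}{t+2}\right)^{2/3}.$$ Then for every $T\ge1$ the iterates $\{x^t\}$ of the algorithm $\|\text{EF21-MVR}\|$ satisfy $$\mathbb{E}\big[\|\nabla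 f(\tilde x^T)\|\big]=\widetilde{\mathcal{O}}\left(\frac{V_0/\gamma_0+\sigma_g\left(1/\sqrt n+1/\alpha^2\right)+\gamma_0E_1}{T^{1/3}}\right),$$ where $\tilde x^T$ is chosen at random from $\{x^0,\dots,x^{T-1}\}$, equal to $x^t$ with probability $\gamma_t/\sum_{s=0}^{T-1}\gamma_s$, $E_1=L+\bar L_{\mathrm{ms}}+\bar L_{\mathrm{ms}}/\alpha^2$ and $\bar L_{\mathrm{ms}}=\frac1n\sum_{i=1}^nL_{\mathrm{ms},i}$.
   Context: $\|\cdot\|$ is the Euclidean norm for vectors and the spectral norm for matrices. A possibly randomized map $\mathcal{C}:\mathbb{R}^d\to\mathbb{R}^d$ is $\alpha$-contractive if $\mathbb{E}\|\mathcal{C}(v)-v\|^2\le(1-\alpha)\|v\|^2$ for all $v\in\mathbb{R}^d$. Algorithm $\|\text{EF21-MVR}\|$. Inputs: $x^0\in\mathbb{R}^d$ and $g_i^0,v_i^0\in\mathbb{R}^d$ for $i=1,\dots,n$ (deterministic), stepsizes $\gamma_t>0$, momentum parameters $\eta_t\in(0,1]$, compressors $\mathcal{C}_i^t$. For $t=0,1,2,\dots$, with $g^t=\frac1n\sum_{i=1}^n g_i^t$: $$x^{t+1}=x^t-\gamma_t\frac{g^t}{\|g^t\|},\qquad v_i^{t+1}=(1-\eta_t)\left(v_i^t+\nabla f_i(x^{t+1};\xi_i^{t+1})-\nabla f_i(x^t;\xi_i^{t+1})\right)+\eta_t\nabla f_i(x^{t+1};\xi_i^{t+1}),$$ $$g_i^{t+1}=g_i^t+\mathcal{C}_i^{t+1}(v_i^{t+1}-g_i^t).$$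 If $g^t=0$, the quotient $g^t/\|g^t\|$ is read as $0$. The samples $\xi_i^{t+1}\sim\mathcal{D}_i$ are independent across clients $i$ and iterations $t$ and independent of everything generated earlier; the randomness of the compressor $\mathcal{C}_i^{t+1}$ is fresh, i.e. independent of its input and of the past. $\displaystyle V_0=f(x^0)-f^{\inf}+\frac{2\gamma_0}{1-\sqrt{1-\alpha}}\cdot\frac1n\sum_{i=1}^n\|g_i^0-v_i^0\|+\frac{2\gamma_0\sqrt{1-\alpha}}{1-\sqrt{1-\alpha}}\cdot\frac1n\sum_{i=1}^n\|v_i^0-\nabla f_i(x^0)\|.$ $A_T=\widetilde{\mathcal{O}}(B_T)$ means that there are universal numerical constants $C>0$, $p\ge0$ (independent of the problem, of the algorithm's inputs, and of $T$) such that $A_T\le C(1+\log(T+1))^pB_T$ for all $T\ge1$. The functions $f_i$ and $f_i(\cdot;\xi_i)$ are as smooth as needed for the gradients and Hessians that appear to exist. *)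

(* Defs.v *)
From HB Require Import structures.
From mathcomp Require Import all_boot all_order all_algebra.
From mathcomp Require Import all_classical all_reals all_analysis.

Set Implicit Arguments.
Unset Strict Implicit.
Unset Printing Implicit Defensive.

Import Order.TTheory GRing.Theory Num.Theory.
Import numFieldNormedType.Exports.

Local Open Scope classical_set_scope.
Local Open Scope ring_scope.

(* Points of R^d are row vectors.  The norm `|x| that the library puts on
   matrices is the max norm, so the Euclidean and spectral norms are defined
   here; the induced topology, hence differentiability, is the same. *)

Definition enorm {R : realType} {d : nat} (x : 'rV[R]_d) : R :=
  Num.sqrt (\sum_j x 0 j ^+ 2).

(* Matrices act on row vectors from the right; the operator norm for the
   Euclidean norm is invariant under transposition. *)
Definition specnorm {R : realType} {m d : nat} (A : 'M[R]_(m, d)) : R :=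
  sup [set enorm (u *m A) | u in [set u : 'rV[R]_m | enorm u <= 1]].

Definition grad {R : realType} {d : nat} (f : 'rV[R]_d -> R) (x : 'rV[R]_d) :
    'rV[R]_d :=
  \row_j 'D_(delta_mx 0 j) f x.

Definition hess {R : realType} {d : nat} (f : 'rV[R]_d -> R) (x : 'rV[R]_d) :
    'M[R]_d :=
  jacobian (grad f) x.

(* Differentiability is Frechet differentiability, so [grad] and [hess] are the
   genuine first and second derivatives. *)
Definition twice_differentiable {R : realType} {d : nat} (f : 'rV[R]_d -> R) :=
  forall x, differentiable f x /\ differentiable (grad f) x.

Definition borel_rV (R : realType) (d : nat) :=
  g_sigma_algebraType (@open 'rV[R]_d).

Section probability.
Context {R : realType} {dO : measure_display} {Omega : measurableType dO}.
Variable P : probability Omega R.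

Definition has_mean {m d : nat} (X : Omega -> 'M[R]_(m, d)) (M : 'M[R]_(m, d)) :=
  forall i j, P.-integrable setT (fun w => (X w i j)%:E) /\
    ('E_P[fun w => X w i j] = (M i j)%:E)%E.

Definition sigma_gen {d'} {S : measurableType d'} (X : Omega -> S) :
    set (set Omega) :=
  preimage_set_system setT X measurable.

Definition indep2 (F G : set (set Omega)) :=
  forall A B, F A -> G B -> (P (A `&` B) = P A * P B)%E.

Definition indep_family {I : finType} (F : I -> set (set Omega)) :=
  forall (J : {set I}) (A : I -> set Omega), (forall i, i \in J -> F i (A i)) ->
    (P (\bigcap_(i in [set` J]) A i) = \prod_(i in J) P (A i))%E.

Definition contractive {d : nat} (alpha : R)
    (C : Omega -> 'rV[R]_d -> 'rV[R]_d) :=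
  forall v, ('E_P[fun w => (enorm (C w v - v) ^+ 2)%R]
             <= ((1 - alpha) * enorm v ^+ 2)%:E)%E.

End probability.

Section algorithm.
Context {R : realType} {d n : nat}.
Let V := 'rV[R]_d.

Record state := State { xs : V; gs : 'I_n -> V; vs : 'I_n -> V }.

Definition average (u : 'I_n -> V) : V := n%:R^-1 *: \sum_i u i.

(* [G i] is the stochastic gradient of client i with the current sample plugged
   in, and [C i] is its compressor with the current internal randomness plugged
   in.  Since 0^-1 = 0, the normalized direction is 0 when the average is 0. *)
Definition ef21_mvr_step (eta gamma : R) (G C : 'I_n -> V -> V) (s : state) :
    state :=
  let g := average (gs s) in
  let x' := xs s - gamma *: ((enorm g)^-1 *: g) in
  let v' i := (1 - eta) *: (vs s i + G i x' - G i (xs s)) + eta *: G i x' in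
  let g' i := gs s i + C i (v' i - gs s i) in
  State x' g' v'.

Fixpoint ef21_mvr (eta gamma : nat -> R) (G C : nat -> 'I_n -> V -> V)
    (s0 : state) (t : nat) : state :=
  if t is t'.+1 then
    ef21_mvr_step (eta t') (gamma t') (G t') (C t')
      (ef21_mvr eta gamma G C s0 t')
  else s0.

End algorithm.

(* [xi i t] is the sample of client i drawn in iteration t (xi_i^{t+1} in the
   usual superscripts) and [kap i t] is the internal randomness of its
   compressor in that iteration. *)
Section randomness.
Context {R : realType} {dO : measure_display} {Omega : measurableType dO}.
Context {n : nat}.
Context {dX : 'I_n -> measure_display} {Xi : forall i, measurableType (dX i)}.
Context {dK : 'I_n -> nat -> measure_display}
        {K : forall i t, measurableType (dK i t)}.
Variable P : probability Omega R.
Variable xi : forall i, nat -> Omega -> Xi i.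
Variable kap : forall i t, Omega -> K i t.

(* The sigma-algebra of everything drawn in iterations 0, ..., t-1, which makes
   x^t, g_i^t and v_i^t measurable. *)
Definition past (t : nat) : set (set Omega) :=
  <<s [set B | exists i s, (s < t)%N /\
        (sigma_gen (xi i s) B \/ sigma_gen (@kap i s) B)] >>.

(* What precedes the compression step of iteration t: the input of each
   compressor is a function of these draws. *)
Definition past_samples (t : nat) : set (set Omega) :=
  <<s past t `|` [set B | exists i, sigma_gen (xi i t) B] >>.

(* The samples of iteration t are mutually independent and independent of the
   past. *)
Definition fresh_samples :=
  forall t, indep_family P (fun o : option 'I_n =>
    if o is Some i then sigma_gen (xi i t) else past t).

(* Nothing is required of the compressors of different clients within one
   iteration, which may share their randomness. *)
Definition fresh_compressors :=
  forall t i, indep2 P (sigma_gen (@kap i t)) (past_samples t).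

End randomness.

Section parameters.
Context {R : realType}.

Definition eta_sched (t : nat) : R := (2 / t.+2%:R) `^ (2 / 3).

Definition gamma_sched (gamma0 : R) (t : nat) : R :=
  gamma0 * (2 / t.+2%:R) `^ (2 / 3).

Definition V0_const {d n : nat} (alpha gamma0 : R) (fi : 'I_n -> 'rV[R]_d -> R)
    (f : 'rV[R]_d -> R) (x0 : 'rV[R]_d) (g0 v0 : 'I_n -> 'rV[R]_d) : R :=
  let r := Num.sqrt (1 - alpha) in
  f x0 - inf (range f)
  + 2 * gamma0 / (1 - r) * (n%:R^-1 * \sum_i enorm (g0 i - v0 i))
  + 2 * gamma0 * r / (1 - r) * (n%:R^-1 * \sum_i enorm (v0 i - grad (fi i) x0)).

Definition E1_const {n : nat} (alpha L : R) (Lms : 'I_n -> R) : R :=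
  let Lbar := n%:R^-1 * \sum_i Lms i in
  L + Lbar + Lbar / alpha ^+ 2.

End parameters.

(* Main.v *)
Require Import Defs.
From HB Require Import structures.
From mathcomp Require Import all_boot all_order all_algebra.
From mathcomp Require Import all_classical all_reals all_analysis.
From mathcomp Require Import measurable_realfun zify ring lra.

Set Implicit Arguments.
Unset Strict Implicit.
Unset Printing Implicit Defensive.

Import Order.TTheory GRing.Theory Num.Theory.
Import numFieldNormedType.Exports.

Local Open Scope classical_set_scope.
Local Open Scope ring_scope.

(* The step size gamma_t = gamma0 eta_t is tied to the momentum, so everything
   reduces to the sequence eta_t.  Three errors are tracked.
   - The estimation error e_i = v_i - grad f_i(x).  Given the past, the fresh
     samples add independent centred noise to (1 - eta_t) e_i, hence
     E|e_i|^2 <- (1 - eta_t)^2 E|e_i|^2 + O(eta_t^2), and E|e_i|^2 = O(eta_t)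
     because eta_t - eta_{t+1} <= eta_t^2 / 2.  Averaging over the n clients
     divides the variance by n.  As eta_0 = 1, v^0 is forgotten after one step.
   - The compression gap g_i - v_i contracts by r = sqrt (1 - alpha) up to the
     drift of v_i, which is O(eta_t); its weighted sum is O(1 / (1 - r)),
     and 1 - r >= alpha / 2.
   - A normalized step decreases f by gamma_t |grad f(x_t)| up to twice the error
     of the direction.  The step from x^0, whose error is not controlled by V_0,
     is handled by gamma_0 |grad f(x^0)| <= f(x^0) - inf f + L gamma_0^2.
   The sums of eta_t^{3/2} and eta_t^2 are logarithmic and the sum of eta_t is at
   least T^{1/3}.
   Conditional expectations are avoided: for a sigma-algebra H independent of a
   draw xi, the pair (identity into (Omega, H), xi) has a product law, so a past
   quantity may be frozen while the draw is integrated (lemma freezing). *)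

(** * Euclidean inner product, norm and client averages *)

Section euclidean.
Context {R : realType} {d : nat}.
Implicit Types (x y : 'rV[R]_d) (a : R).

Definition dot x y : R := \sum_j x 0 j * y 0 j.

Lemma dotC x y : dot x y = dot y x.
Proof. by apply: eq_bigr => j _; rewrite mulrC. Qed.

Lemma dotDl x y z : dot (x + y) z = dot x z + dot y z.
Proof. by rewrite -big_split; apply: eq_bigr => j _; rewrite mxE mulrDl. Qed.

Lemma dotZl a x y : dot (a *: x) y = a * dot x y.
Proof. by rewrite mulr_sumr; apply: eq_bigr => j _; rewrite mxE mulrA. Qed.

Lemma dotNl x y : dot (- x) y = - dot x y.
Proof. by rewrite -scaleN1r dotZl mulN1r. Qed.

Lemma dotDr x y z : dot x (y + z) = dot x y + dot x z.
Proof. by rewrite dotC dotDl !(dotC x). Qed.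

Lemma dotZr a x y : dot x (a *: y) = a * dot x y.
Proof. by rewrite dotC dotZl dotC. Qed.

Lemma dotNr x y : dot x (- y) = - dot x y.
Proof. by rewrite dotC dotNl dotC. Qed.

Lemma enorm_ge0 x : 0 <= enorm x. Proof. exact: sqrtr_ge0. Qed.
Hint Resolve enorm_ge0 : core.

Lemma enorm_sqr x : enorm x ^+ 2 = \sum_j x 0 j ^+ 2.
Proof. by rewrite sqr_sqrtr// sumr_ge0// => j _; exact: sqr_ge0. Qed.

Lemma dotxx x : dot x x = enorm x ^+ 2.
Proof. by rewrite enorm_sqr; apply: eq_bigr => j _; rewrite expr2. Qed.

Lemma enormD_sqr x y : enorm (x + y) ^+ 2 = enorm x ^+ 2 + 2 * dot x y + enorm y ^+ 2.
Proof. by rewrite -!dotxx dotDl !dotDr (dotC y x); ring. Qed.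

Lemma enormN x : enorm (- x) = enorm x.
Proof. by congr Num.sqrt; apply: eq_bigr => j _; rewrite mxE sqrrN. Qed.

Lemma enormZ a x : enorm (a *: x) = `|a| * enorm x.
Proof.
rewrite -sqrtr_sqr -sqrtrM ?sqr_ge0//; congr Num.sqrt.
by rewrite mulr_sumr; apply: eq_bigr => j _; rewrite mxE exprMn.
Qed.

Lemma enorm0 : enorm (0 : 'rV[R]_d) = 0.
Proof. by rewrite -(scale0r 0) enormZ normr0 mul0r. Qed.

Lemma coord_le_enorm x j : `|x 0 j| <= enorm x.
Proof.
rewrite -sqrtr_sqr ler_wsqrtr// (bigD1 j)//= lerDl sumr_ge0// => k _.
exact: sqr_ge0.
Qed.

Lemma enorm0_eq0 x : enorm x = 0 -> x = 0.
Proof.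
move=> x0; apply/rowP => j; rewrite mxE; apply/eqP; rewrite -normr_le0 -x0.
exact: coord_le_enorm.
Qed.

(** Cauchy-Schwarz: the squared norm of [enorm y *: x - enorm x *: y] expands to twice
    [enorm x * enorm y] times the difference of the two sides. Vanishing norms are treated apart so
    that this factor can be cancelled. *)
Lemma dot_le_enorm x y : dot x y <= enorm x * enorm y.
Proof.
have [x0|xn0] := eqVneq (enorm x) 0.
  rewrite x0 mul0r (enorm0_eq0 x0) /dot big1// => j _.
  by rewrite mxE mul0r.
have [y0|yn0] := eqVneq (enorm y) 0.
  rewrite y0 mulr0 (enorm0_eq0 y0) /dot big1// => j _.
  by rewrite mxE mulr0.
have xy0 : 0 < enorm x * enorm y by rewrite mulr_gt0// lt0r ?xn0 ?yn0 /=.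
rewrite -(ler_pM2l xy0) -subr_ge0.
have := sqr_ge0 (enorm (enorm y *: x - enorm x *: y)).
rewrite enormD_sqr dotNr dotZl dotZr enormN !enormZ !ger0_norm//; lra.
Qed.

Lemma ler_enormD x y : enorm (x + y) <= enorm x + enorm y.
Proof.
rewrite -(@ler_pXn2r _ 2) ?nnegrE ?addr_ge0// enormD_sqr sqrrD.
by rewrite lerD2r lerD2l -[leRHS]mulr_natl ler_pM2l// dot_le_enorm.
Qed.

Lemma enormB x y : enorm (x - y) = enorm (y - x).
Proof. by rewrite -enormN opprB. Qed.

Lemma enormD_sqr_le2 x y :
  enorm (x + y) ^+ 2 <= 2 * enorm x ^+ 2 + 2 * enorm y ^+ 2.
Proof.
have := sqr_ge0 (enorm (x - y)).
rewrite !enormD_sqr dotNr enormN; lra.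
Qed.

Lemma ler_enorm_sum (I : Type) (s : seq I) (u : I -> 'rV[R]_d) :
  enorm (\sum_(i <- s) u i) <= \sum_(i <- s) enorm (u i).
Proof.
elim: s => [|i s IH]; first by rewrite !big_nil enorm0.
by rewrite !big_cons (le_trans (ler_enormD _ _))// lerD2l.
Qed.

Lemma enorm_average n (u : 'I_n -> 'rV[R]_d) :
  enorm (average u) <= n%:R^-1 * \sum_i enorm (u i).
Proof.
rewrite /average enormZ ger0_norm ?invr_ge0//.
by rewrite ler_wpM2l ?invr_ge0// ler_enorm_sum.
Qed.

Lemma averageB n (u v : 'I_n -> 'rV[R]_d) :
  average u - average v = average (fun i => u i - v i).
Proof. by rewrite /average -scalerBr sumrB. Qed.

Lemma averageD n (u v : 'I_n -> 'rV[R]_d) :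
  average u + average v = average (fun i => u i + v i).
Proof. by rewrite /average -scalerDr big_split. Qed.

Lemma averageZ n a (u : 'I_n -> 'rV[R]_d) :
  average (fun i => a *: u i) = a *: average u.
Proof. by rewrite /average -scaler_sumr !scalerA mulrC. Qed.

End euclidean.
#[global] Hint Extern 0 (is_true (0 <= enorm _)) => solve [apply: enorm_ge0] : core.

(** * Measurability of random vectors *)

Section vector_measurability.
Context {R : realType} {d : nat} {dT : measure_display} {T : measurableType dT}.
Implicit Types X Y : T -> 'rV[R]_d.

(** Stated by coordinates so that vector operations reduce to real ones; [measurable_rV_borel] and
    [borel_measurable_rV] relate it to the Borel structure in which the compressors are
    measurable. *)
Definition measurable_rV X := forall j, measurable_fun setT (fun w => X w 0 j).

Lemma measurable_rV_cst x : measurable_rV (fun=> x).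
Proof. by move=> j; exact: measurable_cst. Qed.

Lemma measurable_rVD X Y :
  measurable_rV X -> measurable_rV Y -> measurable_rV (fun w => X w + Y w).
Proof.
move=> mX mY j; under eq_fun do rewrite mxE.
exact: measurable_funD.
Qed.

Lemma measurable_rVM (a : T -> R) X : measurable_fun setT a ->
  measurable_rV X -> measurable_rV (fun w => a w *: X w).
Proof.
move=> ma mX j; under eq_fun do rewrite mxE.
exact: measurable_funM.
Qed.

Lemma measurable_rVZ a X : measurable_rV X -> measurable_rV (fun w => a *: X w).
Proof. by apply: measurable_rVM; exact: measurable_cst. Qed.

Lemma measurable_rVN X : measurable_rV X -> measurable_rV (fun w => - X w).
Proof. by move=> /(measurable_rVZ (-1)); under eq_fun do rewrite scaleN1r. Qed.

Lemma measurable_rVB X Y :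
  measurable_rV X -> measurable_rV Y -> measurable_rV (fun w => X w - Y w).
Proof. by move=> mX /measurable_rVN; exact: measurable_rVD. Qed.

Lemma measurable_rV_sum (I : Type) (s : seq I) (X : I -> T -> 'rV[R]_d) :
  (forall i, measurable_rV (X i)) -> measurable_rV (fun w => \sum_(i <- s) X i w).
Proof.
move=> mX; elim: s => [|i s IH].
  by under eq_fun do rewrite big_nil; exact: measurable_rV_cst.
by under eq_fun do rewrite big_cons; exact: measurable_rVD.
Qed.

Lemma measurable_rV_average n (X : 'I_n -> T -> 'rV[R]_d) :
  (forall i, measurable_rV (X i)) ->
  measurable_rV (fun w => average (fun i => X i w)).
Proof. by move=> mX; apply: measurable_rVZ; exact: measurable_rV_sum. Qed.

Lemma measurable_enorm X :
  measurable_rV X -> measurable_fun setT (fun w => enorm (X w)).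
Proof.
move=> mX; apply: (@measurableT_comp _ _ _ _ _ _ (@Num.sqrt R)).
  by apply: continuous_measurable_fun; exact: sqrt_continuous.
by apply: measurable_sum => j; exact: measurable_funX.
Qed.

Lemma measurable_enorm_sqr X :
  measurable_rV X -> measurable_fun setT (fun w => enorm (X w) ^+ 2).
Proof. by move=> mX; apply: measurable_funX; exact: measurable_enorm. Qed.

Lemma measurable_rV_normalize X : measurable_rV X ->
  measurable_rV (fun w => (enorm (X w))^-1 *: X w).
Proof.
move=> mX; apply: measurable_rVM => //.
(* On nonnegative reals inversion is the power with exponent -1, even at 0, where both are 0; the
   convention for a vanishing direction thus costs no case split. *)
under eq_fun do rewrite -powR_inv1//.
by apply: (measurableT_comp (measurable_powR _)); exact: measurable_enorm.
Qed.

End vector_measurability.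

Lemma measurable_rV_comp {R : realType} {d : nat} {d1 d2 : measure_display}
    {T1 : measurableType d1} {T2 : measurableType d2}
    (X : T2 -> 'rV[R]_d) (h : T1 -> T2) :
  measurable_rV X -> measurable_fun setT h -> measurable_rV (fun w => X (h w)).
Proof. by move=> mX mh j; exact: measurableT_comp (mX j) mh. Qed.

(* A vector is approximated by the corner of its cell in the grid of mesh
   1/(k+1); the cells form a countable partition into boxes. *)
Section grid.
Context {R : realType} {d : nat}.

Definition cell (k : nat) (x : 'rV[R]_d) : 'rV[int]_d :=
  \row_j Num.floor (k.+1%:R * x 0 j).

Definition corner (k : nat) (q : 'rV[int]_d) : 'rV[R]_d :=
  \row_j ((q 0 j)%:~R / k.+1%:R).

Lemma corner_cell k (x : 'rV[R]_d) j : `|x 0 j - corner k (cell k x) 0 j| < k.+1%:R^-1.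
Proof.
rewrite !mxE; set y := x 0 j.
have k0 : 0 < k.+1%:R :> R by [].
rewrite -(ltr_pM2l k0) -[X in X * `|_|]ger0_norm// -normrM mulrBr mulfV ?gt_eqF//.
rewrite mulrCA mulfV ?gt_eqF// mulr1.
have /andP[h1 h2] := floor_itv (k.+1%:R * y).
rewrite ger0_norm ?subr_ge0// ltrBlDl.
by move: h2; rewrite intrD.
Qed.

Lemma cell_dist k (x y : 'rV[R]_d) j :
  cell k x = cell k y -> `|x 0 j - y 0 j| < 2 * k.+1%:R^-1.
Proof.
move=> xy; have hx := corner_cell k x j; have hy := corner_cell k y j.
rewrite -(subrKA (corner k (cell k x) 0 j)) (le_lt_trans (ler_normD _ _))//.
rewrite mulr_natl mulr2n ltrD//.
by rewrite xy distrC.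
Qed.

Lemma corner_cvg (x : 'rV[R]_d) : corner k (cell k x) @[k --> \oo] --> x.
Proof.
apply/cvg_ballP => e e0.
have /cvgrPdist_lt/(_ e e0) := @cvg_harmonic R.
apply: filterS => k; rewrite /= sub0r normrN ger0_norm ?invr_ge0// => ke.
split=> // i j; rewrite (ord1 i).
exact: lt_trans (corner_cell k x j) ke.
Qed.

Lemma measurable_cell {dT : measure_display} {T : measurableType dT}
    (X : T -> 'rV[R]_d) k q :
  measurable_rV X -> measurable [set w | cell k (X w) = q].
Proof.
move=> mX.
rewrite [X in measurable X](_ : _ = \bigcap_(j in [set: 'I_d])
    ((fun w => k.+1%:R * X w 0 j) @^-1` `[(q 0 j)%:~R, (q 0 j + 1)%:~R[)).
  apply: fin_bigcap_measurable => // j _; rewrite -[X in measurable X]setTI.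
  have mM : measurable_fun setT (fun w => k.+1%:R * X w 0 j).
    exact: measurable_funM.
  exact: mM.
apply/seteqP; split => [w /= <- j _|w /= h].
  by rewrite /= in_itv/= mxE floor_itv.
apply/rowP => j; rewrite mxE; apply: floor_def.
by have := h j I; rewrite /= in_itv.
Qed.

End grid.

(** An open set is the union of all grid cells, of all meshes, that it contains. This union is
    countable and each cell has a measurable preimage. *)
Lemma measurable_rV_borel {R : realType} {d : nat} {dT : measure_display}
    {T : measurableType dT} (X : T -> 'rV[R]_d) :
  measurable_rV X -> measurable_fun setT (X : T -> borel_rV R d).
Proof.
move=> mX; apply: (@measurability _ _ T (borel_rV R d) setT X (@open 'rV[R]_d)) => //.
move=> _ [U oU <-]; rewrite setTI.
pose C (kq : nat * 'rV[int]_d) := [set x : 'rV[R]_d | cell kq.1 x = kq.2].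
rewrite [X in measurable X](_ : _ = \bigcup_(kq in setT)
    (if `[< C kq `<=` U >] then [set w | cell kq.1 (X w) = kq.2] else set0)).
  apply: countable_bigcupT_measurable; first exact: countableP.
  by move=> -[k q]; case: ifPn => // _; exact: measurable_cell.
apply/seteqP; split => [w /= UXw|w [[k q] _]]; last first.
  by case: ifPn => // /asboolP CU /= wq; exact: CU.
move: (oU); rewrite openE => /(_ _ UXw)/nbhs_ballP[e/= e0 eU].
(* Points of one cell are less than two meshes apart in each coordinate, so a mesh below e/2 keeps
   the cell of [X w] inside the ball of radius e. *)
have /cvgrPdist_lt/(_ (e / 2)) := @cvg_harmonic R.
move=> /(_ ltac:(by rewrite divr_gt0))[N _ /(_ N (leqnn _))].
rewrite /= sub0r normrN ger0_norm ?invr_ge0// => Ne.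
exists (N, cell N (X w)) => //=; case: ifPn => // /asboolP CU.
exfalso; apply: CU => y /= yw; apply: eU; split=> // i j; rewrite (ord1 i).
apply: lt_trans (cell_dist j (esym yw)) _.
by rewrite mulrC -ltr_pdivlMr.
Qed.

Lemma borel_measurable_rV {R : realType} {d : nat} {dT : measure_display}
    {T : measurableType dT} (X : T -> 'rV[R]_d) :
  measurable_fun setT (X : T -> borel_rV R d) -> measurable_rV X.
Proof.
move=> mX j; apply: (measurability _ (RGenOpens.measurableE R)).
move=> _ [_ [a [b ->] <-]]; rewrite setTI; set U := `]a, b[%classic.
have oU : open U by exact: interval_open.
have mV : measurable ((fun x : 'rV[R]_d => x 0 j) @^-1` U : set (borel_rV R d)).
  apply: sub_sigma_algebra.
  by apply: open_comp => // x _; exact: coord_continuous.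
by have := mX measurableT _ mV; rewrite setTI.
Qed.

Lemma continuous_measurable_rV {R : realType} {d e : nat} {dT : measure_display}
    {T : measurableType dT} (g : 'rV[R]_d -> 'rV[R]_e) (X : T -> 'rV[R]_d) :
  continuous g -> measurable_rV X -> measurable_rV (fun w => g (X w)).
Proof.
move=> cg /measurable_rV_borel mX; apply: borel_measurable_rV.
apply: (@measurability _ _ T (borel_rV R e) setT (g \o X) (@open 'rV[R]_e)) => //.
move=> _ [U oU <-]; rewrite setTI.
have mV : measurable (g @^-1` U : set (borel_rV R d)).
  by apply: sub_sigma_algebra; apply: open_comp => // x _; exact: cg.
by have := mX measurableT _ mV; rewrite setTI.
Qed.

(** With [X] rounded to grid corners, the first argument of [g] takes countably many values and
    joint measurability is a countable union of rectangles. Continuity in the first argument then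
    gives the claim as a pointwise limit. *)
Lemma measurable_rV_caratheodory {R : realType} {d e : nat}
    {dT dS : measure_display} {T : measurableType dT} {S : measurableType dS}
    (g : 'rV[R]_d -> S -> 'rV[R]_e) (X : T -> 'rV[R]_d) :
  (forall z, continuous (g ^~ z)) -> (forall x, measurable_rV (g x)) ->
  measurable_rV X -> measurable_rV (fun q : (T * S)%type => g (X q.1) q.2).
Proof.
move=> cg mg mX j.
apply: (@measurable_fun_cvg _ _ _ _
  (fun k q => g (corner k (cell k (X q.1))) q.2 0 j)); last first.
  move=> [w z] _ /=.
  apply: (@cvg_comp _ _ _ (fun k => g (corner k (cell k (X w))) z)
    (fun M : 'rV[R]_e => M 0 j) _ (nbhs (g (X w) z))).
    apply: (@cvg_comp _ _ _ (fun k => corner k (cell k (X w))) (g ^~ z)).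
      exact: corner_cvg.
    exact: cg.
  exact: coord_continuous.
move=> k _ B mB; rewrite setTI.
rewrite [X in measurable X](_ : _ = \bigcup_(q in [set: 'rV[int]_d])
    ([set w | cell k (X w) = q] `*` [set z | B (g (corner k q) z 0 j)])).
  apply: countable_bigcupT_measurable; first exact: countableP.
  move=> q; apply: measurableX; first exact: measurable_cell.
  by have := mg (corner k q) j measurableT _ mB; rewrite setTI.
apply/seteqP; split => [[w z] /= h|[w z] /= [q _ [/= <-]]//].
by exists (cell k (X w)).
Qed.

(** * Integrating an independent draw with the past frozen *)

Section freezing.
Context {R : realType} {dO : measure_display} {Omega : measurableType dO}.
Context {dS : measure_display} {S : measurableType dS}.
Variable P : probability Omega R.
Variable xi : {RV P >-> S}.
Variable H : set (set Omega).
Hypothesis mH : H `<=` measurable.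
Hypothesis HI : setI_closed H.
Hypothesis HT : H setT.
Hypothesis indH : indep2 P (sigma_gen xi) H.

Local Notation T := (g_sigma_algebraType H).

Lemma sub_sigma_measurable (A : set Omega) : <<s H >> A -> measurable A.
Proof. exact: (smallest_sub (@sigma_algebra_measurable _ Omega) mH). Qed.

(** For a fixed event A' of the draw, B -> P(B and A') and B -> P(A') P(B) are finite measures that
    agree on the pi-system [H], hence on the sigma-algebra it generates. *)
Lemma indep2_sigma : indep2 P (sigma_gen xi) (<<s H >>).
Proof.
move=> A B [C mC <-] sB; rewrite setTI.
set A' := xi @^-1` C.
have mA' : measurable A'.
  by rewrite -[A']setTI; exact: (measurable_funP xi).
have PA0 : (0 <= fine (P A'))%R by rewrite fine_ge0.
pose m1 := mrestr P mA'.
pose m2 := mscale (NngNum PA0) P.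
have mm A0 : H A0 -> m1 A0 = m2 A0.
  move=> HA0; rewrite /m1 /m2 /mrestr /mscale/= setIC indH//; last first.
    by exists C => //; rewrite setTI.
  by rewrite fineK ?fin_num_measure.
have m12 : m1 B = m2 B.
  apply: (@g_sigma_algebra_measure_unique _ R _ H mH (fun=> setT)) => //.
  - by rewrite bigcup_const.
  - move=> k; rewrite /m1 /= /mrestr setTI.
    by rewrite (le_lt_trans (probability_le1 _ _))// ltry.
move: m12; rewrite /m1 /m2 /mrestr /mscale/= setIC => ->.
by rewrite fineK ?fin_num_measure.
Qed.

Let idH : Omega -> T := idfun.
Let mid : measurable_fun setT idH.
Proof.
move=> _ B mB; rewrite setTI preimage_id.
exact: sub_sigma_measurable.
Qed.
HB.instance Definition _ := isMeasurableFun.Build _ _ _ _ idH mid.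
Let idX : {RV P >-> T} := idH.

Let pr (w : Omega) : (T * S)%type := (w, xi w).
Let mpr : measurable_fun setT pr.
Proof. by apply: measurable_fun_pair => //; exact: (measurable_funP xi). Qed.
HB.instance Definition _ := isMeasurableFun.Build _ _ _ _ pr mpr.
Let prX : {RV P >-> (T * S)%type} := pr.

(** By [indep2_sigma], the law of [pr] agrees on rectangles with the product of the laws of [idX]
    and [xi], so it is that product. Tonelli then integrates the draw first. *)
Lemma freezing (h : (T * S)%type -> \bar R) :
  measurable_fun setT h -> (forall q, 0 <= h q)%E ->
  (\int[P]_w h (w, xi w) = \int[P]_w \int[distribution P xi]_z h (w, z))%E.
Proof.
move=> mh h0.
have -> : (\int[P]_w h (w, xi w) = \int[distribution P prX]_q h q)%E.
  by rewrite ge0_integral_distribution.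
have -> : (\int[P]_w \int[distribution P xi]_z h (w, z) =
           \int[distribution P idX]_w \int[distribution P xi]_z h (w, z))%E.
  rewrite ge0_integral_distribution//.
  - exact: measurable_fun_fubini_tonelli_F.
  - by move=> w; apply: integral_ge0.
rewrite -fubini_tonelli1//; apply: eq_measure_integral => A mA _.
apply/esym/(product_measure_unique (m' := distribution P prX)) => // B C mB mC.
rewrite /= /distribution /pushforward/=.
rewrite [X in P X](_ : _ = (xi @^-1` C) `&` B); last by rewrite setIC.
rewrite muleC indep2_sigma//; exists C => //; by rewrite setTI.
Qed.

End freezing.

(** * Upper bounds on means of nonnegative variables *)

Section mean_bounds.
Context {R : realType} {dT : measure_display} {T : measurableType dT}.
Variable P : probability T R.
Implicit Types (X Y : T -> R) (a b c : R).

(** Measurability and nonnegativity travel with the bound, so that bounds can be added, scaled and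
    compared without separate integrability arguments. *)
Definition mean_le X a :=
  [/\ measurable_fun setT X, (forall w, 0 <= X w) & ('E_P[X] <= a%:E)%E].

Lemma mean_le_trans X a b : mean_le X a -> a <= b -> mean_le X b.
Proof. by move=> [mX X0 Xa] ab; split=> //; rewrite (le_trans Xa)// lee_fin. Qed.

Lemma mean_le_eq X Y a : (forall w, X w = Y w) -> mean_le X a -> mean_le Y a.
Proof. by move=> /funext ->. Qed.

Lemma mean_le_mono Y X a : measurable_fun setT X -> (forall w, 0 <= X w) ->
  (forall w, X w <= Y w) -> mean_le Y a -> mean_le X a.
Proof.
move=> mX X0 XY [mY Y0 Ya]; split=> //; apply: le_trans Ya.
by apply: expectation_le => //; exact: aeW.
Qed.

Lemma mean_leD X Y a b :
  mean_le X a -> mean_le Y b -> mean_le (fun w => X w + Y w) (a + b).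
Proof.
move=> [mX X0 Xa] [mY Y0 Yb]; split; first exact: measurable_funD.
  by move=> w; rewrite addr_ge0.
move: Xa Yb; rewrite unlock EFinD => Xa Yb.
under eq_integral do rewrite EFinD.
rewrite ge0_integralD//; do ?[by move=> w _; rewrite lee_fin].
- exact: leeD.
- exact/measurable_EFinP.
- exact/measurable_EFinP.
Qed.

Lemma mean_leZ c X a :
  0 <= c -> mean_le X a -> mean_le (fun w => c * X w) (c * a).
Proof.
move=> c0 [mX X0 Xa]; split; first exact: measurable_funM.
  by move=> w; rewrite mulr_ge0.
move: Xa; rewrite unlock EFinM => Xa.
under eq_integral do rewrite EFinM.
rewrite ge0_integralZl_EFin//; do ?[by move=> w _; rewrite lee_fin].
- by apply: lee_wpmul2l; rewrite ?lee_fin.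
- exact/measurable_EFinP.
Qed.

Lemma mean_le_cst c : 0 <= c -> mean_le (fun=> c) c.
Proof.
move=> c0; split=> //.
by rewrite (_ : (fun=> c) = cst c)// expectation_cst.
Qed.

Lemma mean_le_sum (I : Type) (s : seq I) (X : I -> T -> R) (a : I -> R) :
  (forall i, mean_le (X i) (a i)) ->
  mean_le (fun w => \sum_(i <- s) X i w) (\sum_(i <- s) a i).
Proof.
move=> h; elim: s => [|i s IH].
  rewrite big_nil (_ : (fun=> _) = fun=> 0); last first.
    by apply/funext => w; rewrite big_nil.
  by apply: mean_le_cst; rewrite lexx.
rewrite big_cons (_ : (fun=> _) = fun w => X i w + \sum_(i <- s) X i w).
  exact: mean_leD.
by apply/funext => w; rewrite big_cons.
Qed.

(** Jensen's inequality for the square. The slack e keeps the divisor positive when [a] is 0 and is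
    removed in the limit. *)
Lemma mean_le_sqrt X a : measurable_fun setT X -> (forall w, 0 <= X w) ->
  0 <= a -> ('E_P[fun w => (X w ^+ 2)%R] <= (a ^+ 2)%:E)%E -> mean_le X a.
Proof.
move=> mX X0 a0 Xa; split=> //; apply/lee_addgt0Pr => e e0.
have s0 : 0 < a + e by rewrite ltr_wpDl.
suff [_ _] : mean_le X (a + e) by rewrite EFinD.
(* AM-GM: X <= X^2 / (2 s) + s / 2 with s = a + e *)
apply: (@mean_le_mono (fun w => (2 * (a + e))^-1 * X w ^+ 2 + (a + e) / 2)) => //.
  move=> w; rewrite -subr_ge0 [leRHS](_ : _ = (2 * (a + e))^-1 * (X w - (a + e)) ^+ 2).
    by rewrite mulr_ge0 ?sqr_ge0// invr_ge0 mulr_ge0// ltW.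
  by field; rewrite gt_eqF.
apply: (@mean_le_trans _ ((2 * (a + e))^-1 * a ^+ 2 + (a + e) / 2)).
  apply: mean_leD; last by apply: mean_le_cst; rewrite divr_ge0// ltW.
  apply: mean_leZ; first by rewrite invr_ge0 mulr_ge0// ltW.
  by split => //; [exact: measurable_funX|move=> w; exact: sqr_ge0].
rewrite [leRHS](_ : _ = (2 * (a + e))^-1 * (a + e) ^+ 2 + (a + e) / 2); last first.
  by field; rewrite gt_eqF.
rewrite lerD2r ler_wpM2l//; first by rewrite invr_ge0 mulr_ge0// ltW.
by rewrite ler_sqr ?nnegrE ?lerDl// ltW.
Qed.

End mean_bounds.

(** * Means and second moments of random vectors *)

Section vector_means.
Context {R : realType} {d : nat} {dT : measure_display} {T : measurableType dT}.
Variable P : probability T R.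
Implicit Types (Z A B : T -> 'rV[R]_d) (M N b : 'rV[R]_d).

Lemma has_mean_measurable Z M : has_mean P Z M -> measurable_rV Z.
Proof.
by move=> h j; have [/measurable_int + _] := h 0 j; move/measurable_EFinP.
Qed.

Lemma has_mean_cst M : has_mean P (fun=> M) M.
Proof.
move=> i j; split.
  by apply: finite_measure_integrable_cst.
by rewrite (_ : (fun=> _) = cst (M i j))// expectation_cst.
Qed.

Lemma has_mean_subZ Z A M N c : has_mean P Z M -> has_mean P A N ->
  has_mean P (fun w => Z w - c *: A w) (M - c *: N).
Proof.
move=> hZ hA i j; have [iZ EZ] := hZ i j; have [iA EA] := hA i j.
have E w : ((Z w - c *: A w) i j)%:E = ((Z w i j)%:E + (- c)%:E * (A w i j)%:E)%E.
  by rewrite !mxE -EFinM -EFinD mulNr.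
have icA : P.-integrable setT (fun w => (- c)%:E * (A w i j)%:E)%E.
  exact: integrableZl.
split.
  by under eq_fun do rewrite E; exact: integrableD.
move: EZ EA; rewrite unlock => EZ EA.
under eq_integral do rewrite E.
rewrite integralD// EZ integralZl// EA -EFinM -EFinD !mxE; congr (_%:E).
by rewrite mulNr.
Qed.

Lemma integral_dot Z M b : has_mean P Z M ->
  P.-integrable setT (fun w => (dot b (Z w))%:E) /\
  (\int[P]_w (dot b (Z w))%:E = (dot b M)%:E)%E.
Proof.
move=> hZ.
have E w : ((dot b (Z w))%:E = \sum_(j < d) (b 0 j)%:E * (Z w 0 j)%:E)%E.
  by rewrite sumEFin.
have ij j : P.-integrable setT (fun w => (b 0 j)%:E * (Z w 0 j)%:E)%E.
  by apply: integrableZl => //; have [] := hZ 0 j.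
split; first by under eq_fun do rewrite E; exact: integrable_sum.
under eq_integral do rewrite E.
rewrite integral_sum// -sumEFin; apply: eq_bigr => j _.
have [iZ] := hZ 0 j; rewrite unlock => EZ.
by rewrite integralZl// EZ -EFinM.
Qed.

(** Expand the square; the cross term is linear in Z and integrates to its value at the mean. Used
    with b = -M to center a vector, and with M = 0 to add centred noise to a frozen b. *)
Lemma mean_le_enorm_shift Z M b q : has_mean P Z M ->
  ('E_P[fun w => (enorm (Z w) ^+ 2)%R] <= q%:E)%E ->
  mean_le P (fun w => enorm (Z w + b) ^+ 2) (q + 2 * dot b M + enorm b ^+ 2).
Proof.
move=> hZ Zq; have mZ := has_mean_measurable hZ.
have [iD ED] := integral_dot b hZ.
have iZ : P.-integrable setT (fun w => (enorm (Z w) ^+ 2)%:E).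
  apply/integrableP; split; first by apply/measurable_EFinP/measurable_enorm_sqr.
  under eq_integral do rewrite gee0_abs ?lee_fin ?sqr_ge0//.
  by rewrite expectation.unlock in Zq; rewrite (le_lt_trans Zq)// ltry.
split.
- by apply: measurable_enorm_sqr; apply: measurable_rVD => //; exact: measurable_rV_cst.
- by move=> w; exact: sqr_ge0.
rewrite !expectation.unlock in Zq *.
have E w : ((enorm (Z w + b) ^+ 2)%:E = (enorm (Z w) ^+ 2)%:E +
    (2%:E * (dot b (Z w))%:E + (enorm b ^+ 2)%:E))%E.
  by rewrite -EFinM -!EFinD enormD_sqr (dotC (Z w)) addrA.
under eq_integral do rewrite E.
have i2D : P.-integrable setT (fun w => 2%:E * (dot b (Z w))%:E)%E.
  exact: integrableZl.
have ic : P.-integrable setT (fun w => (enorm b ^+ 2)%:E).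
  exact: finite_measure_integrable_cst.
have EC : (\int[P]_w (enorm b ^+ 2)%:E = (enorm b ^+ 2)%:E)%E.
  by have := expectation_cst P (enorm b ^+ 2); rewrite expectation.unlock.
rewrite integralD//; last exact: integrableD.
rewrite integralD// integralZl// ED EC.
have -> : q + 2 * dot b M + enorm b ^+ 2 = q + (2 * dot b M + enorm b ^+ 2).
  by rewrite addrA.
exact: (leeD Zq (lexx (2 * dot b M + enorm b ^+ 2)%:E)).
Qed.

End vector_means.

(** * Mean bounds obtained by freezing *)

Section frozen_means.
Context {R : realType} {dO : measure_display} {Omega : measurableType dO}.
Context {dS : measure_display} {S : measurableType dS}.
Variable P : probability Omega R.
Variable xi : {RV P >-> S}.
Variable H : set (set Omega).
Hypothesis mH : H `<=` measurable.

Lemma measurable_fun_coarse {d'} {S' : measurableType d'} (X : Omega -> S') :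
  measurable_fun setT (X : g_sigma_algebraType H -> S') ->
  measurable_fun setT X.
Proof.
move=> mX _ B mB; apply: (sub_sigma_measurable mH).
exact: mX.
Qed.

Lemma measurable_fun_draw {d'} {S' : measurableType d'}
    (h : (g_sigma_algebraType H * S)%type -> S') :
  measurable_fun setT h -> measurable_fun setT (fun w => h (w, xi w)).
Proof.
move=> mh; have mid : measurable_fun setT (idfun : Omega -> g_sigma_algebraType H).
  by move=> _ B mB; rewrite setTI preimage_id; exact: (sub_sigma_measurable mH).
have mpr : measurable_fun setT
    (fun w => (w, xi w) : (g_sigma_algebraType H * S)%type).
  by apply: measurable_fun_pair => //; exact: (measurable_funP xi).
exact: (measurableT_comp mh mpr).
Qed.

Hypothesis HI : setI_closed H.
Hypothesis HT : H setT.
Hypothesis indH : indep2 P (sigma_gen xi) H.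

(** Plays the part of the tower property: [b w] bounds the mean over the draw with the past frozen
    at [w], and it remains to average [b]. *)
Lemma mean_le_freezing (h : (g_sigma_algebraType H * S)%type -> R)
    (b : Omega -> R) (a : R) :
  measurable_fun setT h -> (forall q, 0 <= h q) -> mean_le P b a ->
  (forall w, ('E_(distribution P xi)[fun z => h (w, z)] <= (b w)%:E)%E) ->
  mean_le P (fun w => h (w, xi w)) a.
Proof.
move=> mh h0 [mb b0 ba] hb; split => //; first exact: measurable_fun_draw.
apply: le_trans ba; rewrite unlock in hb *.
have mh' : measurable_fun setT (EFin \o h) by exact/measurable_EFinP.
have h0' q : (0 <= (EFin \o h) q)%E by rewrite lee_fin.
rewrite (freezing mH HI HT indH mh' h0').
apply: ge0_le_integral => //.
- by move=> w _; apply: integral_ge0 => z _; rewrite lee_fin.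
- apply: measurable_fun_coarse.
  by apply: measurable_fun_fubini_tonelli_F => // q; rewrite lee_fin.
- exact/measurable_EFinP.
- by move=> w _; exact: hb.
Qed.

End frozen_means.

(** * The step size schedule *)

Section schedule.
Context {R : realType}.

(** With u_t^3 = (t+2)/2 and eta_t = u_t^(-2), inequalities between fractional powers become
    polynomial inequalities in u_t and u_{t+1}. *)
Let base (t : nat) : R := t.+2%:R / 2.
Let u (t : nat) : R := base t `^ (1 / 3).

Let base_ge1 t : 1 <= base t.
Proof. by rewrite ler_pdivlMr// mul1r ler_nat. Qed.

Let base_ge0 t : 0 <= base t.
Proof. exact: le_trans ler01 (base_ge1 t). Qed.

Let u_ge1 t : 1 <= u t.
Proof.
have -> : 1 = 1 `^ (1 / 3) :> R by rewrite powR1.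
by apply: ge0_ler_powR => //; rewrite ?nnegrE ?divr_ge0//; exact: base_ge0.
Qed.

Let u_gt0 t : 0 < u t. Proof. exact: lt_le_trans ltr01 (u_ge1 t). Qed.

Let u_cube t : u t ^+ 3 = base t.
Proof.
rewrite -powR_mulrn ?powR_ge0// -powRrM (_ : 1 / 3 * 3 = 1); last by field.
by rewrite powRr1// base_ge0.
Qed.

Let eta_u t : eta_sched t = (u t ^+ 2)^-1.
Proof.
rewrite /eta_sched -[X in X `^ _ = _]invrK invf_div -/(base t).
rewrite -powR_inv1 ?base_ge0// -powRrM mulN1r powRN; congr (_^-1).
rewrite -powR_mulrn ?powR_ge0// -powRrM; congr (_ `^ _).
by field.
Qed.

Let u_step t : u t.+1 ^+ 3 = u t ^+ 3 + 1 / 2.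
Proof. by rewrite !u_cube /base -(natr1 t.+2); field. Qed.

Let u_lt t : u t < u t.+1.
Proof.
rewrite -(@ltr_pXn2r _ 3) ?nnegrE ?ltW//.
by rewrite u_step ltrDl.
Qed.

Lemma eta_sched0 : eta_sched 0 = 1 :> R.
Proof. by rewrite /eta_sched divff// powR1. Qed.

Lemma eta_sched_gt0 t : 0 < eta_sched t :> R.
Proof. by rewrite eta_u invr_gt0 exprn_gt0. Qed.

Lemma eta_sched_ge0 t : 0 <= eta_sched t :> R.
Proof. exact: ltW (eta_sched_gt0 t). Qed.

Lemma eta_sched_le1 t : eta_sched t <= 1 :> R.
Proof. by rewrite eta_u invf_le1 ?exprn_gt0// exprn_ege1. Qed.

Lemma eta_sched_le s t : (s <= t)%N -> eta_sched t <= eta_sched s :> R.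
Proof.
elim: t => [|t IH]; first by rewrite leqn0 => /eqP ->.
rewrite leq_eqVlt => /predU1P[->//|]; rewrite ltnS => /IH; apply: le_trans.
by rewrite !eta_u lef_pV2 ?posrE ?exprn_gt0// ler_sqr ?nnegrE ?ltW.
Qed.

(** With x = u_t and y = u_{t+1} the claim reads 2 x^2 (y^2 - x^2) <= y^2. Factoring y^3 - x^3 = 1/2
    gives 3 x^2 (y - x) <= 1/2, so the left side is at most (x + y)/3, which is below y^2 because 1
    <= x < y. *)
Lemma eta_schedB t :
  eta_sched t - eta_sched t.+1 <= eta_sched t ^+ 2 / 2 :> R.
Proof.
rewrite !eta_u; set x := u t; set y := u t.+1.
have x1 : 1 <= x by exact: u_ge1.
have xy : x < y by exact: u_lt.
have y3 : y ^+ 3 = x ^+ 3 + 1 / 2 by exact: u_step.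
have x0 : 0 < x by exact: u_gt0.
have y0 : 0 < y by exact: u_gt0.
rewrite -subr_ge0 (_ : _ - _ = (y ^+ 2 - 2 * x ^+ 2 * (y ^+ 2 - x ^+ 2)) /
    (2 * x ^+ 4 * y ^+ 2)); last by field; rewrite !gt_eqF.
apply: divr_ge0; last by rewrite ltW// !mulr_gt0 ?exprn_gt0.
have dxy : (y - x) * (3 * x ^+ 2) <= 1 / 2.
  have -> : 1 / 2 = (y - x) * (y ^+ 2 + x * y + x ^+ 2).
    by rewrite -[LHS](addKr (x ^+ 3)) -y3; ring.
  rewrite ler_pM2l ?subr_gt0//; nra.
have : 2 * x ^+ 2 * (y ^+ 2 - x ^+ 2) <= (x + y) / 3.
  rewrite (_ : 2 * x ^+ 2 * (y ^+ 2 - x ^+ 2) =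
    (2 / 3 * (x + y)) * ((y - x) * (3 * x ^+ 2))); last by field.
  rewrite (_ : (x + y) / 3 = (2 / 3 * (x + y)) * (1 / 2)); last by field.
  by rewrite ler_pM2l// mulr_gt0// addr_gt0.
nra.
Qed.

(* The margin of the recursion a_{t+1} <= (1 - eta_t)^2 a_t + c eta_t^2. *)
Lemma eta_sched_rec t :
  (1 - eta_sched t) ^+ 2 * (2 * eta_sched t) + eta_sched t ^+ 2
    <= 2 * eta_sched t.+1 :> R.
Proof.
have := eta_schedB t; have := eta_sched_le1 t; have := eta_sched_ge0 t.
move: (eta_sched t) (eta_sched t.+1) => a b a0 a1; nra.
Qed.

(** Starts the recursion: as eta_0 = 1, the first step leaves c, which must be at most 2 c eta_1. *)
Lemma eta_sched1_ge : 1 <= 2 * eta_sched 1 :> R.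
Proof. by have := eta_sched_rec 0; rewrite eta_sched0; lra. Qed.

(** The exponent 2/3 makes eta_t^(3/2) exactly harmonic, hence logarithmic sums. *)
Lemma eta_sched_sqrt t :
  eta_sched t * Num.sqrt (eta_sched t) = 2 / t.+2%:R :> R.
Proof.
rewrite eta_u -exprVn sqrtr_sqr ger0_norm ?invr_ge0 ?ltW//.
by rewrite -exprSr exprVn u_cube invf_div.
Qed.

Lemma eta_sched_sqr_le t : eta_sched t ^+ 2 <= 2 / t.+2%:R :> R.
Proof.
rewrite -eta_sched_sqrt expr2 ler_pM2l ?eta_sched_gt0//.
have e0 := eta_sched_ge0 t; have e1 := eta_sched_le1 t.
rewrite -[leLHS]sqr_sqrtr// expr2 ler_piMr ?sqrtr_ge0//.
by rewrite -sqrtr1 ler_wsqrtr.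
Qed.

(** Telescoping: ln(1 + z) <= z at z = -1/(T+2) gives 1/(T+2) <= ln(T+2) - ln(T+1). *)
Lemma sum_harmonic_le T : \sum_(t < T) 2 / t.+2%:R <= 2 * ln T.+1%:R :> R.
Proof.
elim: T => [|T IH]; first by rewrite big_ord0 ln1 mulr0.
rewrite big_ord_recr/=; apply: le_trans (lerD IH (lexx _)) _.
rewrite -mulrDr ler_pM2l// -lerBrDl -lerN2 opprB -ln_div ?posrE//.
have -> : T.+1%:R / T.+2%:R = 1 + - (T.+2%:R)^-1 :> R.
  have n0 : T.+2%:R != 0 :> R by rewrite pnatr_eq0.
  have -> : T.+1%:R = T.+2%:R - 1 :> R by rewrite -(natr1 T.+1) addrK.
  by rewrite mulrBl divff// mul1r.
apply: le_ln1Dx; rewrite ltrN2 invf_lt1// ltr1n //.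
Qed.

(** Each s < T has (s+2)/2 <= T, so each of the T terms is at least T^(-2/3). *)
Lemma sum_eta_sched_ge T : (0 < T)%N ->
  T%:R `^ (1 / 3) <= \sum_(s < T) eta_sched s :> R.
Proof.
move=> T0; set c := T%:R `^ (1 / 3).
have T0' : 0 < T%:R :> R by rewrite ltr0n.
have c0 : 0 < c by exact: powR_gt0.
have c3 : c ^+ 3 = T%:R.
  rewrite -powR_mulrn ?powR_ge0// -powRrM (_ : 1 / 3 * 3 = 1); last by field.
  by rewrite powRr1// ltW.
have cE (s : 'I_T) : (c ^+ 2)^-1 <= eta_sched s.
  have uc : u s <= c.
    rewrite -(@ler_pXn2r _ 3)// ?nnegrE ?powR_ge0// u_cube c3 /base.
    rewrite ler_pdivrMr// -natrM ler_nat.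
    by have := ltn_ord s; lia.
  by rewrite eta_u lef_pV2 ?posrE ?exprn_gt0// lerXn2r// nnegrE powR_ge0.
apply: le_trans (ler_sum _ (fun s _ => cE s)).
rewrite sumr_const card_ord -[_ *+ T]mulr_natr -c3.
by rewrite (_ : _ * _ = c)//; field; rewrite gt_eqF.
Qed.

End schedule.

(** * Weighted sums of the compression gap and the final arithmetic *)

Fixpoint gap_bound {R : realType} (r u0 : R) (b : nat -> R) (t : nat) : R :=
  if t is t'.+1 then r * (gap_bound r u0 b t' + b t') else u0.

Lemma gap_bound_ge0 {R : realType} (r u0 : R) (b : nat -> R) t :
  0 <= r -> 0 <= u0 -> (forall t, 0 <= b t) -> 0 <= gap_bound r u0 b t.
Proof.
by move=> r0 u00 b0; elim: t => //= t IH; rewrite mulr_ge0// addr_ge0.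
Qed.

(** Writing U for the bound, monotonicity of eta gives eta_{t+1} U_{t+1} <= r (eta_t U_t + eta_t^2
    m_t). The induction carries the boundary term eta_T U_T on the left, where it absorbs this
    inequality, and drops it at the end. *)
Lemma sum_gap_bound_le {R : realType} (r u0 : R) (m : nat -> R) T :
  0 <= r -> 0 <= u0 -> (forall t, 0 <= m t) ->
  (1 - r) * \sum_(t < T) eta_sched t * gap_bound r u0 (fun t => eta_sched t * m t) t
    <= u0 + r * \sum_(t < T) eta_sched t ^+ 2 * m t.
Proof.
move=> r0 u00 m0; set U := gap_bound _ _ _.
have U0 t : 0 <= U t.
  by apply: gap_bound_ge0 => // s; rewrite mulr_ge0// eta_sched_ge0.
suff : (1 - r) * (\sum_(t < T) eta_sched t * U t) + eta_sched T * U T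
    <= u0 + r * \sum_(t < T) eta_sched t ^+ 2 * m t.
  by apply: le_trans; rewrite lerDl mulr_ge0// eta_sched_ge0.
elim: T => [|T IH]; first by rewrite !big_ord0 eta_sched0 /U/= !mulr0 mul1r addr0 add0r.
have US : U T.+1 = r * (U T + eta_sched T * m T) by [].
have dec : eta_sched T.+1 * U T.+1 <= eta_sched T * U T.+1.
  by rewrite ler_wpM2r ?eta_sched_le.
rewrite 2!big_ord_recr; change (nat_of_ord ord_max) with T.
move: IH dec; rewrite US; move: (eta_sched T) (eta_sched T.+1) (U T) (m T).
move: (\sum_(t < T) _) (\sum_(t < T) _) => A B a a1 b c /=; lra.
Qed.

(** To be read as in [weighted_bound_le]: l is the logarithm, the p's are the terms of the target
    times gamma0 (up to the displayed factors 2), and q5, q8 are p5, p8 with r/(1-r) in place of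
    1/alpha^2. The constant 24 is the coefficient 12 of the q's times their factor 2. *)
Lemma weighted_arith {R : realType} (l p1 p2 p3 p4 p5 p6 p7 p8 q5 q8 : R) :
  0 <= l -> 0 <= p1 -> 0 <= p2 -> 0 <= p3 -> 0 <= p4 -> 0 <= p5 -> 0 <= p6 ->
  0 <= p7 -> 0 <= p8 -> q5 <= 2 * p5 -> q8 <= 2 * p8 ->
  3 * p1 + 3 * p6 + 8 * (l * (p4 + p7)) + 2 * p2 + 2 * p3
    + 12 * (l * (q5 + q8)) + 2 * (l * p6) <=
  24 * ((p1 + 2 * p2 + 2 * p3 + p4 + p5 + p6 + p7 + p8)
    + l * (p1 + 2 * p2 + 2 * p3 + p4 + p5 + p6 + p7 + p8)).
Proof.
move=> l0 p10 p20 p30 p40 p50 p60 p70 p80 q5p q8p.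
have lp (u : R) : 0 <= u -> 0 <= l * u by exact: mulr_ge0.
have := lp _ p10; have := lp _ p20; have := lp _ p30; have := lp _ p40.
have := lp _ p50; have := lp _ p60; have := lp _ p70; have := lp _ p80.
have : l * q5 <= l * (2 * p5) by rewrite ler_wpM2l.
have : l * q8 <= l * (2 * p8) by rewrite ler_wpM2l.
lra.
Qed.

(** * Descent inequalities for a smooth function *)

Section descent.
Context {R : realType} {d : nat}.
Variable f : 'rV[R]_d -> R.
Hypothesis df : forall x : 'rV[R]_d, differentiable f x.

Lemma derive_dot (x h : 'rV[R]_d) : 'D_h f x = dot (grad f x) h.
Proof.
rewrite deriveE// {1}(row_sum_delta h) linear_sum/= /dot.
apply: eq_bigr => j _.
by rewrite linearZ/= mxE deriveE// mulrC.
Qed.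

Lemma is_derive_line (x h : 'rV[R]_d) (s : R) :
  is_derive s (1 : R) (fun r => f (x + r *: h)) (dot (grad f (x + s *: h)) h).
Proof.
have E : (fun r : R => r^-1 *: (((fun r => f (x + r *: h)) \o shift s) (r *: 1)
           - f (x + s *: h))) =
         (fun r => r^-1 *: ((f \o shift (x + s *: h)) (r *: h) - f (x + s *: h))).
  apply/funext => r /=; congr (_ *: (f _ - _)).
  by rewrite [r *: 1]mulr1 scalerDl addrCA.
have D : derivable f (x + s *: h) h by exact: diff_derivable.
split; first by rewrite /derivable E.
by rewrite -derive_dot /derive E.
Qed.

Variable L : R.
Hypothesis L_ge0 : 0 <= L.
Hypothesis lipf : forall x y, enorm (grad f x - grad f y) <= L * enorm (x - y).

(** The mean value theorem on the segment gives the gradient at an intermediate point, which differs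
    from [grad f x] by at most L |h|. This yields L where integration would give L/2; only numerical
    constants are affected. *)
Lemma descent_quadratic x h :
  f (x + h) <= f x + dot (grad f x) h + L * enorm h ^+ 2.
Proof.
have cf : {within `[0, 1], continuous (fun r : R => f (x + r *: h))}.
  apply: continuous_subspaceT => s; apply: differentiable_continuous.
  by apply/derivable1_diffP; have [] := is_derive_line x h s.
have [c c01] := MVT_segment ler01 (fun s _ => is_derive_line x h s) cf.
rewrite scale1r scale0r addr0 subr0 mulr1 => /eqP; rewrite subr_eq => /eqP ->.
rewrite addrC -addrA lerD2l -lerBlDl -dotNl -dotDl.
apply: le_trans (dot_le_enorm _ _) _.
rewrite expr2 mulrA ler_wpM2r//; apply: le_trans (lipf _ _) _.
rewrite ler_wpM2l// addrAC subrr add0r enormZ.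
move: c01; rewrite in_itv/= => /andP[c0 c1].
by rewrite ger0_norm// ler_piMl.
Qed.

(** For v the normalized g, -<grad f, v> = -<grad f - g, v> - |g| <= |grad f - g| - |g|, and |g| >=
    |grad f| - |grad f - g|. If g = 0 then v = 0 and <g, v> = |g| still holds. *)
Lemma descent_normalized x g gam : 0 <= gam ->
  f (x - gam *: ((enorm g)^-1 *: g)) <=
    f x - gam * enorm (grad f x) + 2 * gam * enorm (grad f x - g) + L * gam ^+ 2.
Proof.
move=> gam0; apply: le_trans (descent_quadratic _ _) _.
set v := (enorm g)^-1 *: g.
have v1 : enorm v <= 1.
  rewrite enormZ ger0_norm ?invr_ge0//.
  by have [->|g0] := eqVneq (enorm g) 0; rewrite ?mulr0// mulVf.
have gv : dot g v = enorm g.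
  rewrite dotZr dotxx; have [->|g0] := eqVneq (enorm g) 0.
    by rewrite expr0n mulr0.
  by rewrite expr2 mulrA mulVf ?mul1r.
apply: lerD; last first.
  rewrite ler_wpM2l// enormN enormZ ger0_norm// exprMn.
  by rewrite ler_piMr ?sqr_ge0// exprn_ile1.
rewrite -addrA lerD2l dotNr dotZr -mulrN.
rewrite -mulrA mulrCA -mulrN -mulrDr ler_wpM2l//.
rewrite -[X in dot X v](subrK g) dotDl gv opprD.
have h1 : - dot (grad f x - g) v <= enorm (grad f x - g).
  rewrite -dotNl; apply: le_trans (dot_le_enorm _ _) _.
  by rewrite enormN ler_piMr.
have h2 : enorm (grad f x) <= enorm (grad f x - g) + enorm g.
  by rewrite -{1}[grad f x](subrK g) ler_enormD.
lra.
Qed.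

(** A step along the exact gradient has no direction error and cannot go below the infimum. *)
Lemma grad_le_gap x gam : has_lbound (range f) -> 0 <= gam ->
  gam * enorm (grad f x) <= f x - inf (range f) + L * gam ^+ 2.
Proof.
move=> lbf gam0.
have := descent_normalized x (grad f x) gam0; rewrite subrr enorm0 mulr0 addr0.
have : inf (range f) <= f (x - gam *: ((enorm (grad f x))^-1 *: grad f x)).
  by apply: inf_lbound => //; exists (x - gam *: ((enorm (grad f x))^-1 *: grad f x)).
lra.
Qed.

End descent.

(** * Generated sigma-algebras and pi-systems *)

Section generated_types.
Context {T : pointedType}.
Implicit Types G : set (set T).

Lemma measurable_fun_finer {G1 G2 : set (set T)} {d'}
    {S : measurableType d'} (X : T -> S) :
  G1 `<=` <<s G2 >> ->
  measurable_fun setT (X : g_sigma_algebraType G1 -> S) ->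
  measurable_fun setT (X : g_sigma_algebraType G2 -> S).
Proof.
move=> G12 mX _ B mB.
apply: (smallest_sub (@smallest_sigma_algebra _ setT G2) G12).
exact: mX.
Qed.

Lemma measurable_rV_finer {R : realType} {d : nat} {G1 G2 : set (set T)}
    (X : T -> 'rV[R]_d) : G1 `<=` <<s G2 >> ->
  measurable_rV (X : g_sigma_algebraType G1 -> _) ->
  measurable_rV (X : g_sigma_algebraType G2 -> _).
Proof. by move=> G12 mX j; exact: measurable_fun_finer (mX j). Qed.

End generated_types.

Lemma sigma_algebra_setI_closed {T : pointedType} (G : set (set T)) :
  setI_closed <<s G >>.
Proof.
by move=> A B mA mB; exact: (@measurableI _ (g_sigma_algebraType G)).
Qed.

Lemma sigma_algebra_setT {T : pointedType} (G : set (set T)) : <<s G >> setT.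
Proof. exact: (@measurableT _ (g_sigma_algebraType G)). Qed.

Section sigma_gen_theory.
Context {dO : measure_display} {Omega : measurableType dO}.
Context {dS : measure_display} {S : measurableType dS}.

Lemma sigma_gen_setI_closed (X : Omega -> S) : setI_closed (sigma_gen X).
Proof.
move=> _ _ [A mA <-] [B mB <-]; exists (A `&` B); first exact: measurableI.
by rewrite !setTI preimage_setI.
Qed.

Lemma sigma_gen_setT (X : Omega -> S) : sigma_gen X setT.
Proof. by exists setT => //; rewrite setTI preimage_setT. Qed.

Lemma sigma_gen_measurable (X : Omega -> S) :
  measurable_fun setT X -> sigma_gen X `<=` measurable.
Proof. by move=> mX _ [A mA <-]; exact: mX. Qed.

Lemma measurable_fun_sigma_gen (X : Omega -> S) (G : set (set Omega)) :
  sigma_gen X `<=` <<s G >> ->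
  measurable_fun setT (X : g_sigma_algebraType G -> S).
Proof. by move=> XG _ B mB; apply: XG; exists B. Qed.

End sigma_gen_theory.

(* When the F_i are independent pi-systems, so are F_o and the pi-system
   generated by all the others. *)
Section rest.
Context {R : realType} {dO : measure_display} {Omega : measurableType dO}.
Variable P : probability Omega R.
Context {I : finType}.
Variable F : I -> set (set Omega).
Hypothesis mF : forall i, F i `<=` measurable.
Hypothesis FI : forall i, setI_closed (F i).
Hypothesis FT : forall i, F i setT.

Definition rest (o : I) : set (set Omega) :=
  [set \bigcap_(i in [set` [set~ o]%SET]) A i | A in [set A | forall i, F i (A i)]].

Lemma rest_measurable o : rest o `<=` measurable.
Proof.
move=> _ [A FA <-]; apply: fin_bigcap_measurable => // i _.
by apply: mF; exact: FA.
Qed.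

Lemma rest_setI_closed o : setI_closed (rest o).
Proof.
move=> _ _ [A FA <-] [B FB <-]; exists (fun i => A i `&` B i).
  by move=> i; exact: FI.
by rewrite bigcapI.
Qed.

Lemma rest_setT o : rest o setT.
Proof.
exists (fun=> setT) => //; apply/seteqP; split=> // w _ i //.
Qed.

Lemma sub_rest o i : i != o -> F i `<=` rest o.
Proof.
move=> io A FA; exists (fun j => if j == i then A else setT).
  by move=> j /=; case: eqP => [->|].
apply/seteqP; split => [w /(_ i)|w Aw j _ /=]; last by case: ifP.
by rewrite eqxx; apply; rewrite /= !inE.
Qed.

(** Put B at index [o] of the family and use independence twice: over all indices and over those
    other than [o]. *)
Lemma indep2_rest o : indep_family P F -> indep2 P (F o) (rest o).
Proof.
move=> indF B _ FB [A FA <-].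
pose A' i := if i == o then B else A i.
have FA' i : F i (A' i) by rewrite /A'; case: eqP => [->|].
have -> : \bigcap_(i in [set` [set~ o]%SET]) A i = \bigcap_(i in [set` [set~ o]%SET]) A' i.
  apply: eq_bigcapr => i; rewrite /= !inE /A' => /negbTE io.
  by rewrite io.
rewrite (_ : B `&` _ = \bigcap_(i in [set` [set: I]%SET]) A' i); last first.
  apply/seteqP; split => [w [Bw Aw] i _|w h].
    have [->|io] := eqVneq i o; first by rewrite /A' eqxx.
    by apply: Aw; rewrite /= !inE.
  split; last by move=> i _; apply: h; rewrite /= inE.
  by have := h o; rewrite /A' eqxx; apply; rewrite /= inE.
rewrite !indF// (bigD1 o)//= /A' eqxx; congr (_ * _)%E.
by apply: eq_bigl => i; rewrite !inE.
Qed.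

End rest.

(** * Second moment of the momentum noise *)

Section noise.
Context {R : realType} {d : nat} {dS : measure_display} {S : measurableType dS}.
Variable D : probability S R.
Variable G : 'rV[R]_d -> S -> 'rV[R]_d.
Variable dF : 'rV[R]_d -> 'rV[R]_d.
Variables sigma L : R.
Hypothesis G_mean : forall u, has_mean D (G u) (dF u).
Hypothesis G_var : forall u,
  ('E_D[fun z => (enorm (G u z - dF u) ^+ 2)%R] <= (sigma ^+ 2)%:E)%E.
Hypothesis G_lip : forall u u', ('E_D[fun z => (enorm (G u z - G u' z) ^+ 2)%R]
  <= (L ^+ 2 * enorm (u - u') ^+ 2)%:E)%E.

(* The increment of v_t - grad f(x_t) caused by a fresh sample z at the step
   from u to u'. *)
Definition mvr_noise (eta : R) u u' z :=
  (G u' z - (1 - eta) *: G u z) - (dF u' - (1 - eta) *: dF u).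

Let mG u : measurable_rV (G u). Proof. exact: has_mean_measurable (G_mean u). Qed.

Lemma has_mean_mvr_noise eta u u' : has_mean D (mvr_noise eta u u') 0.
Proof.
have := has_mean_subZ 1 (has_mean_subZ (1 - eta) (G_mean u') (G_mean u))
  (has_mean_cst D (dF u' - (1 - eta) *: dF u)).
by rewrite scale1r subrr.
Qed.

Lemma mean_le_sample_error u :
  mean_le D (fun z => enorm (G u z - dF u) ^+ 2) (sigma ^+ 2).
Proof.
split=> // [|z]; last exact: sqr_ge0.
by apply: measurable_enorm_sqr; apply: measurable_rVB => //; exact: measurable_rV_cst.
Qed.

Lemma mean_le_sample_increment u u' :
  mean_le D (fun z => enorm (G u' z - G u z) ^+ 2) (L ^+ 2 * enorm (u' - u) ^+ 2).
Proof.
split=> // [|z]; last exact: sqr_ge0.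
by apply: measurable_enorm_sqr; exact: measurable_rVB.
Qed.

(** The noise is eta times the sampling error at u' plus (1 - eta) times the centred gradient
    increment. Centering does not raise a second moment, and (1 - eta)^2 <= 1. *)
Lemma mean_le_mvr_noise eta u u' : 0 <= eta <= 1 ->
  mean_le D (fun z => enorm (mvr_noise eta u u' z) ^+ 2)
    (2 * eta ^+ 2 * sigma ^+ 2 + 2 * (L ^+ 2 * enorm (u' - u) ^+ 2)).
Proof.
move=> /andP[eta0 eta1].
pose B z := (G u' z - G u z) - (dF u' - dF u).
have mB : mean_le D (fun z => enorm (B z) ^+ 2) (L ^+ 2 * enorm (u' - u) ^+ 2).
  have hM : has_mean D (fun z => G u' z - G u z) (dF u' - dF u).
    have := has_mean_subZ 1 (G_mean u') (G_mean u).
    by rewrite scale1r; under [X in has_mean _ X _]eq_fun do rewrite scale1r.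
  have [_ _ h] := mean_le_sample_increment u u'.
  have := mean_le_enorm_shift (- (dF u' - dF u)) hM h.
  rewrite dotNl dotxx enormN.
  move/mean_le_trans; apply.
  by have := sqr_ge0 (enorm (dF u' - dF u)); lra.
have mN : measurable_rV (mvr_noise eta u u').
  exact: has_mean_measurable (has_mean_mvr_noise _ _ _).
apply: (@mean_le_mono _ _ _ D (fun z =>
    2 * eta ^+ 2 * enorm (G u' z - dF u') ^+ 2 + 2 * enorm (B z) ^+ 2)).
- exact: measurable_enorm_sqr.
- by move=> z; exact: sqr_ge0.
- move=> z.
  have -> : mvr_noise eta u u' z = eta *: (G u' z - dF u') + (1 - eta) *: B z.
    rewrite /mvr_noise /B; apply/rowP => j; rewrite !mxE; ring.
  apply: le_trans (enormD_sqr_le2 _ _) _.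
  rewrite !enormZ !ger0_norm ?subr_ge0// !exprMn mulrA lerD2l.
  rewrite ler_pM2l// ler_piMl ?sqr_ge0// exprn_ile1 ?subr_ge0//.
  by rewrite gerBl.
- apply: mean_leD; apply: mean_leZ => //; last exact: mean_le_sample_error.
  by rewrite mulr_ge0// sqr_ge0.
Qed.

Hypothesis sigma_ge0 : 0 <= sigma.
Hypothesis L_ge0 : 0 <= L.

Lemma mean_le_sample_error1 u : mean_le D (fun z => enorm (G u z - dF u)) sigma.
Proof.
apply: mean_le_sqrt => //.
by apply: measurable_enorm; apply: measurable_rVB => //; exact: measurable_rV_cst.
Qed.

Lemma mean_le_sample_increment1 u u' :
  mean_le D (fun z => enorm (G u' z - G u z)) (L * enorm (u' - u)).
Proof.
apply: mean_le_sqrt => //; last 2 first.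
- by rewrite mulr_ge0.
- by rewrite exprMn.
- by apply: measurable_enorm; exact: measurable_rVB.
Qed.

End noise.

(** * The run of the algorithm: filtration and adaptedness *)

Section run.
Context {R : realType} {d n : nat}.
Context {dX : 'I_n -> measure_display} {Xi : forall i, measurableType (dX i)}.
Variable D : forall i, probability (Xi i) R.
Variable grd : forall i, 'rV[R]_d -> Xi i -> 'rV[R]_d.
Context {dO : measure_display} {Omega : measurableType dO}.
Variable P : probability Omega R.
Variable xi : forall i, nat -> {RV P >-> Xi i}.
Context {dK : 'I_n -> nat -> measure_display} {K : forall i t, measurableType (dK i t)}.
Variable kap : forall i t, {RV P >-> K i t}.
Variable cmp : forall i t, K i t -> 'rV[R]_d -> 'rV[R]_d.
Arguments grd : clear implicits.
Arguments cmp : clear implicits.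
Variables (eta gam : nat -> R).
Variables (x0 : 'rV[R]_d) (g0 v0 : 'I_n -> 'rV[R]_d).

Local Notation xiF := (fun i t => xi i t : Omega -> Xi i).
Local Notation kapF := (fun i t => kap i t : Omega -> K i t).
Local Notation before t := (past xiF kapF t).
Local Notation sampled t := (past_samples xiF kapF t).

Lemma before_sub_sampled t : before t `<=` sampled t.
Proof. by move=> A tA; apply: sub_gen_smallest; left. Qed.

Lemma sample_sub_sampled i t : sigma_gen (xiF i t) `<=` sampled t.
Proof. by move=> A tA; apply: sub_gen_smallest; right; exists i. Qed.

Lemma sampled_sub_before t : sampled t `<=` before t.+1.
Proof.
apply: smallest_sub; first exact: smallest_sigma_algebra.
move=> A [|[i iA]]; last first.
  by apply: sub_gen_smallest; exists i, t; split => //; left.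
apply: smallest_sub => //; first exact: smallest_sigma_algebra.
move=> B [i [s [st sB]]]; apply: sub_gen_smallest; exists i, s; split => //.
exact: ltnW.
Qed.

Lemma before_le s t : (s <= t)%N -> before s `<=` before t.
Proof.
elim: t => [|t IH]; first by rewrite leqn0 => /eqP ->.
rewrite leq_eqVlt => /predU1P[->//|/IH st].
apply: subset_trans st _; apply: subset_trans (@sampled_sub_before t).
exact: before_sub_sampled.
Qed.

Lemma draw_sub_before i t : sigma_gen (kapF i t) `<=` before t.+1.
Proof.
by move=> A tA; apply: sub_gen_smallest; exists i, t; split => //; right.
Qed.

Lemma before_measurable t : before t `<=` measurable.
Proof.
apply: smallest_sub; first exact: sigma_algebra_measurable.
by move=> A [i [s [_ []]]]; apply: sigma_gen_measurable.
Qed.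

Lemma sampled_measurable t : sampled t `<=` measurable.
Proof.
exact: subset_trans (@sampled_sub_before t) (@before_measurable t.+1).
Qed.

Let S t w := ef21_mvr eta gam (fun s i u => grd i u (xi i s w))
  (fun s i => cmp i s (kap i s w)) (State x0 g0 v0) t.
Let x t w := xs (S t w).
Let g t w := gs (S t w).
Let v t w := vs (S t w).

Hypothesis grd_cont : forall i z, continuous (grd i ^~ z).
Hypothesis grd_meas : forall i u, measurable_rV (grd i u).
Hypothesis cmp_meas : forall i t, measurable_fun setT
  (fun q : K i t * borel_rV R d => cmp i t q.1 q.2 : borel_rV R d).

Lemma x_next t w :
  x t.+1 w = x t w - gam t *: ((enorm (average (g t w)))^-1 *: average (g t w)).
Proof. by []. Qed.

Lemma v_next t i w :
  v t.+1 w i = (1 - eta t) *: (v t w i + grd i (x t.+1 w) (xi i t w)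
    - grd i (x t w) (xi i t w)) + eta t *: grd i (x t.+1 w) (xi i t w).
Proof. by []. Qed.

Lemma g_next t i w :
  g t.+1 w i = g t w i + cmp i t (kap i t w) (v t.+1 w i - g t w i).
Proof. by []. Qed.

(** [G] is only a generating family: it may be a pi-system such as [others t i] below, for which
    freezing is available. *)
Definition adapted (G : set (set Omega)) (X : Omega -> 'rV[R]_d) :=
  measurable_rV (X : g_sigma_algebraType G -> 'rV[R]_d).

Lemma adapted_finer (G1 G2 : set (set Omega)) (X : Omega -> 'rV[R]_d) :
  G1 `<=` G2 -> adapted G1 X -> adapted G2 X.
Proof.
by move=> G12; apply: measurable_rV_finer => A /G12; exact: sub_gen_smallest.
Qed.

Lemma adapted_measurable (G : set (set Omega)) (X : Omega -> 'rV[R]_d) :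
  G `<=` measurable -> adapted G X -> measurable_rV X.
Proof. by move=> mG mX j; exact: (measurable_fun_coarse mG (mX j)). Qed.

Lemma adapted_grd (G : set (set Omega)) i t (X : Omega -> 'rV[R]_d) :
  adapted G X -> sigma_gen (xiF i t) `<=` G ->
  adapted G (fun w => grd i (X w) (xi i t w)).
Proof.
move=> mX xiG.
have mxi : measurable_fun setT (xi i t : g_sigma_algebraType G -> Xi i).
  by apply: measurable_fun_sigma_gen => A /xiG; exact: sub_gen_smallest.
have mpr : measurable_fun setT
    (fun w : g_sigma_algebraType G => (w, xi i t w)).
  by apply: (measurable_fun_pair _ mxi); exact: measurable_id.
exact: (measurable_rV_comp
  (measurable_rV_caratheodory (@grd_cont i) (@grd_meas i) mX) mpr).
Qed.

(** The new point depends on g_t and x_t alone, so it is known before the samples of iteration t are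
    drawn. Hence both x_t and x_{t+1} can be frozen while these samples are integrated. *)
Lemma adapted_x_next t :
  (forall i, adapted (before t) (fun w => g t w i)) ->
  adapted (before t) (x t) -> adapted (before t) (x t.+1).
Proof.
move=> mg mx.
apply: measurable_rVB => //; apply: measurable_rVZ.
apply: measurable_rV_normalize; exact: measurable_rV_average.
Qed.

Lemma adapted_v_next t i :
  adapted (before t) (x t) -> adapted (before t) (x t.+1) ->
  adapted (before t) (fun w => v t w i) ->
  adapted (sampled t) (fun w => v t.+1 w i).
Proof.
move=> mx mx' mv.
have mG X : adapted (before t) X ->
    adapted (sampled t) (fun w => grd i (X w) (xi i t w)).
  move=> /(adapted_finer (@before_sub_sampled t)) mX.
  by apply: adapted_grd => //; exact: sample_sub_sampled.
have mv' := adapted_finer (@before_sub_sampled t) mv.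
apply: measurable_rVD; apply: measurable_rVZ; last exact: mG.
by apply: measurable_rVB; [apply: measurable_rVD => //|]; exact: mG.
Qed.

Lemma adapted_state t :
  [/\ adapted (before t) (x t),
      forall i, adapted (before t) (fun w => g t w i) &
      forall i, adapted (before t) (fun w => v t w i)].
Proof.
elim: t => [|t [mx mg mv]].
  by split => [|i|i]; exact: measurable_rV_cst.
have mx' := adapted_x_next mg mx.
have mv' i := adapted_v_next mx mx' (mv i).
have sb := @sampled_sub_before t.
have bb : before t `<=` before t.+1 by exact: before_le.
split => [|i|i]; first exact: adapted_finer mx'.
  apply: (@measurable_rVD _ _ _ (g_sigma_algebraType (before t.+1))).
    exact: adapted_finer (mg i).
  have mZ : measurable_rV ((fun w => v t.+1 w i - g t w i)
      : g_sigma_algebraType (before t.+1) -> 'rV[R]_d).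
    apply: measurable_rVB; first exact: adapted_finer (mv' i).
    exact: adapted_finer (mg i).
  have mk : measurable_fun setT
      (kap i t : g_sigma_algebraType (before t.+1) -> K i t).
    apply: measurable_fun_sigma_gen => A /draw_sub_before.
    exact: sub_gen_smallest.
  apply: borel_measurable_rV.
  apply: (measurableT_comp (@cmp_meas i t)
    (measurable_fun_pair mk (measurable_rV_borel mZ))).
exact: adapted_finer (mv' i).
Qed.


(** * One-step mean bounds for the estimation error and the compression gap *)

Variable dF : 'I_n -> 'rV[R]_d -> 'rV[R]_d.
Variables (sigma alpha : R) (L : 'I_n -> R).
Hypothesis dF_cont : forall i, continuous (dF i).
Hypothesis grd_mean : forall i u, has_mean (D i) (grd i u) (dF i u).
Hypothesis grd_var : forall i u,
  ('E_(D i)[fun z => (enorm (grd i u z - dF i u) ^+ 2)%R] <= (sigma ^+ 2)%:E)%E.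
Hypothesis grd_lip : forall i u u',
  ('E_(D i)[fun z => (enorm (grd i u z - grd i u' z) ^+ 2)%R]
    <= (L i ^+ 2 * enorm (u - u') ^+ 2)%:E)%E.
Hypothesis sigma_ge0 : 0 <= sigma.
Hypothesis L_ge0 : forall i, 0 <= L i.
Hypothesis eta01 : forall t, 0 <= eta t <= 1.
Hypothesis gam_ge0 : forall t, 0 <= gam t.
Hypothesis distr_xi : forall i t A, measurable A -> distribution P (xi i t) A = D i A.
Hypothesis fresh_xi : fresh_samples P xiF kapF.
Hypothesis fresh_kap : fresh_compressors P xiF kapF.
Hypothesis contr : forall i t, contractive P alpha (fun w => cmp i t (kap i t w)).
Hypothesis alpha_le1 : alpha <= 1.

Lemma step_length t w : enorm (x t.+1 w - x t w) <= gam t.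
Proof.
rewrite x_next addrC addKr enormN enormZ ger0_norm// ler_piMr//.
rewrite enormZ ger0_norm ?invr_ge0//.
by have [->|g_neq0] := eqVneq (enorm (average (g t w))) 0; rewrite ?mulr0// mulVf.
Qed.

Let draws t (o : option 'I_n) : set (set Omega) :=
  if o is Some i then sigma_gen (xiF i t) else before t.

Let draws_measurable t o : draws t o `<=` measurable.
Proof.
by case: o => [i|] /=; [exact: sigma_gen_measurable|exact: before_measurable].
Qed.

Let draws_setI t o : setI_closed (draws t o).
Proof.
by case: o => [i|]; [exact: sigma_gen_setI_closed|exact: sigma_algebra_setI_closed].
Qed.

Let draws_setT t o : draws t o setT.
Proof. by case: o => [i|]; [exact: sigma_gen_setT|exact: sigma_algebra_setT]. Qed.

(* Everything drawn up to iteration t, except the sample of client i. *)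
Let others t i := rest (draws t) (Some i).

Let before_sub_others t i : before t `<=` others t i.
Proof. exact: (sub_rest (@draws_setT t) (o := Some i) (i := None)). Qed.

Let sample_sub_others t i j : j != i -> sigma_gen (xiF j t) `<=` others t i.
Proof. by move=> ji; exact: (sub_rest (@draws_setT t) (o := Some i) (i := Some j)). Qed.

(** Freezes the past together with the samples of the other clients, so that noise can be integrated
    one client at a time. *)
Lemma mean_le_fresh_sample t i
    (h : (g_sigma_algebraType (others t i) * Xi i)%type -> R) (b : Omega -> R) a :
  measurable_fun setT h -> (forall q, 0 <= h q) -> mean_le P b a ->
  (forall w, ('E_(D i)[fun z => h (w, z)] <= (b w)%:E)%E) ->
  mean_le P (fun w => h (w, xi i t w)) a.
Proof.
move=> mh h0 ba hb.
have mH : others t i `<=` measurable by apply: rest_measurable; exact: draws_measurable.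
have HI : setI_closed (others t i) by apply: rest_setI_closed; exact: draws_setI.
have HT : others t i setT by apply: rest_setT; exact: draws_setT.
have indH : indep2 P (sigma_gen (xi i t)) (others t i).
  exact: (@indep2_rest _ _ _ P _ (draws t) (Some i) (@fresh_xi t)).
apply: (mean_le_freezing mH HI HT indH mh h0 ba) => w.
apply: le_trans (hb w); rewrite !expectation.unlock.
by rewrite (eq_measure_integral (D i))// => A mA _; exact: distr_xi.
Qed.

Local Notation noise t i w z := (mvr_noise (grd i) (dF i) (eta t) (x t w) (x t.+1 w) z).

Let noise_var t i : R := 2 * eta t ^+ 2 * sigma ^+ 2 + 2 * (L i ^+ 2 * gam t ^+ 2).

Let noise_var_ge0 t i : 0 <= noise_var t i.
Proof.
have := sqr_ge0 (eta t * sigma); have := sqr_ge0 (L i * gam t).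
rewrite /noise_var !exprMn; lra.
Qed.

Let adapted_x t : adapted (before t) (x t).
Proof. by have [] := adapted_state t. Qed.

Let adapted_xS t : adapted (before t) (x t.+1).
Proof. by apply: adapted_x_next; have [] := adapted_state t. Qed.

Lemma measurable_noise t i (G : set (set Omega)) : before t `<=` G ->
  measurable_rV (fun q : (g_sigma_algebraType G * Xi i)%type =>
    noise t i q.1 q.2).
Proof.
move=> tG.
have mx := adapted_finer tG (@adapted_x t).
have mx' := adapted_finer tG (@adapted_xS t).
have c X : adapted G X -> measurable_rV (fun q : (g_sigma_algebraType G * Xi i)%type =>
    dF i (X q.1)).
  move=> mX; apply: (measurable_rV_comp (X := fun w : g_sigma_algebraType G => dF i (X w))).
    exact: continuous_measurable_rV.
  exact: measurable_fst.
apply: measurable_rVB; apply: measurable_rVB; try apply: measurable_rVZ;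
  do ?[exact: c|exact: measurable_rV_caratheodory].
Qed.

Lemma adapted_noise t i a (s : seq 'I_n) : i \notin s ->
  adapted (others t i) (fun w => \sum_(j <- s) a *: noise t j w (xi j t w)).
Proof.
elim: s => [_|j s IH].
  by rewrite (_ : (fun w => _) = fun=> 0);
    [exact: measurable_rV_cst|apply/funext => w; rewrite big_nil].
rewrite inE negb_or => /andP[ij /IH mS].
rewrite (_ : (fun w => _) = fun w => a *: noise t j w (xi j t w)
    + \sum_(j <- s) a *: noise t j w (xi j t w)); last first.
  by apply/funext => w; rewrite big_cons.
apply: (@measurable_rVD _ _ _ (g_sigma_algebraType (others t i))) => //.
apply: (@measurable_rVZ _ _ _ (g_sigma_algebraType (others t i))).
have mxi : measurable_fun setT (xi j t : g_sigma_algebraType (others t i) -> Xi j).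
  apply: measurable_fun_sigma_gen => A jA; apply: sub_gen_smallest.
  by move: jA; apply: sample_sub_others; rewrite eq_sym.
have mpr : measurable_fun setT
    (fun w : g_sigma_algebraType (others t i) => (w, xi j t w)).
  by apply: (measurable_fun_pair _ mxi); exact: measurable_id.
exact: (measurable_rV_comp (measurable_noise (@before_sub_others t i)) mpr).
Qed.

(** Induction on the clients: the partial sum over [s] does not involve the sample of i, so it is
    frozen, and the cross term vanishes because the noise of i is centred. Variances add up instead
    of norms. *)
Lemma mean_le_add_noise t (W : Omega -> 'rV[R]_d) q a (s : seq 'I_n) :
  uniq s -> adapted (before t) W ->
  mean_le P (fun w => enorm (W w) ^+ 2) q ->
  mean_le P (fun w => enorm (W w + \sum_(i <- s) a *: noise t i w (xi i t w)) ^+ 2)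
    (q + a ^+ 2 * \sum_(i <- s) noise_var t i).
Proof.
move=> + mW Wq; elim: s => [_|i s IH /= /andP[iNs us]].
  under [X in mean_le _ X _]eq_fun do rewrite big_nil addr0.
  by rewrite big_nil mulr0 addr0.
pose W' w := W w + \sum_(i <- s) a *: noise t i w (xi i t w).
rewrite (_ : (fun w => _) = fun w =>
    enorm (a *: noise t i w (xi i t w) + W' w) ^+ 2); last first.
  by apply/funext => w; rewrite big_cons /W' addrCA.
rewrite big_cons mulrDr addrCA addrC.
have mW' : adapted (others t i) W'.
  apply: measurable_rVD; first exact: adapted_finer (@before_sub_others t i) mW.
  exact: adapted_noise.
apply: (mean_le_fresh_sample (h := fun q => enorm (a *: noise t i q.1 q.2 + W' q.1) ^+ 2)
  (b := fun w => enorm (W' w) ^+ 2 + a ^+ 2 * noise_var t i)).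
- apply: measurable_enorm_sqr; apply: measurable_rVD.
    by apply: measurable_rVZ; exact: measurable_noise.
  by apply: (measurable_rV_comp mW'); exact: measurable_fst.
- by move=> q'; exact: sqr_ge0.
- apply: mean_leD; first exact: IH.
  by apply: mean_le_cst; rewrite mulr_ge0 ?sqr_ge0.
- move=> w.
  have hN := has_mean_mvr_noise (@grd_mean i) (eta t) (x t w) (x t.+1 w).
  have hA : has_mean (D i) (fun z => a *: noise t i w z) 0.
    have := has_mean_subZ (- a) (has_mean_cst (D i) 0) hN.
    rewrite scaler0 subr0; under [X in has_mean _ X _]eq_fun do
      rewrite scaleNr opprK add0r.
    by [].
  have [_ _ Nq] := mean_leZ (sqr_ge0 a)
    (mean_le_mvr_noise (@grd_mean i) (@grd_var i) (@grd_lip i) (x t w) (x t.+1 w)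
      (@eta01 t)).
  have Aq : ('E_(D i)[fun z => (enorm (a *: noise t i w z) ^+ 2)%R]
      <= (a ^+ 2 * noise_var t i)%:E)%E.
    apply: (@le_trans _ _ _ _ _ _ (le_trans Nq _)).
      rewrite le_eqVlt; apply/orP; left; apply/eqP; congr expectation.
      by apply/funext => z; rewrite enormZ exprMn real_normK ?num_real.
    rewrite lee_fin ler_wpM2l ?sqr_ge0// lerD2l ler_pM2l// ler_wpM2l ?sqr_ge0//.
    by rewrite lerXn2r ?nnegrE// step_length.
  have [_ _] := mean_le_enorm_shift (W' w) hA Aq.
  have -> : dot (W' w) (0 : 'rV[R]_d) = 0 by rewrite -(scale0r 0) dotZr mul0r.
  by rewrite mulr0 addr0 addrC.
Qed.

Local Notation err t i w := (v t w i - dF i (x t w)).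
Local Notation gap t i w := (g t w i - v t w i).

Lemma err_next t i w :
  err t.+1 i w = (1 - eta t) *: err t i w + noise t i w (xi i t w).
Proof. by rewrite v_next /mvr_noise; apply/rowP => j; rewrite !mxE; ring. Qed.

Lemma adapted_err t i : adapted (before t) (fun w => err t i w).
Proof.
have [mx _ mv] := adapted_state t.
apply: measurable_rVB; first exact: mv.
exact: continuous_measurable_rV.
Qed.

Lemma mean_le_err_next t i q :
  mean_le P (fun w => enorm (err t i w) ^+ 2) q ->
  mean_le P (fun w => enorm (err t.+1 i w) ^+ 2)
    ((1 - eta t) ^+ 2 * q + noise_var t i).
Proof.
move=> /(mean_leZ (sqr_ge0 (1 - eta t))) eq.
have eq' : mean_le P (fun w => enorm ((1 - eta t) *: err t i w) ^+ 2)
    ((1 - eta t) ^+ 2 * q).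
  by apply: mean_le_eq eq => w; rewrite [in RHS]enormZ exprMn real_normK ?num_real.
have := mean_le_add_noise 1 (s := [:: i]) isT
  (measurable_rVZ (1 - eta t) (@adapted_err t i)) eq'.
rewrite big_seq1 expr1n mul1r.
by apply: mean_le_eq => w; rewrite big_seq1 scale1r -err_next.
Qed.

(** All clients at once with weight 1/n: the variances are summed and then multiplied by 1/n^2,
    which is the source of the variance reduction. *)
Lemma mean_le_avg_err_next t q :
  mean_le P (fun w => enorm (average (fun i => err t i w)) ^+ 2) q ->
  mean_le P (fun w => enorm (average (fun i => err t.+1 i w)) ^+ 2)
    ((1 - eta t) ^+ 2 * q + n%:R^-1 ^+ 2 * \sum_i noise_var t i).
Proof.
move=> /(mean_leZ (sqr_ge0 (1 - eta t))) eq.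
have eq' : mean_le P
    (fun w => enorm ((1 - eta t) *: average (fun i => err t i w)) ^+ 2)
    ((1 - eta t) ^+ 2 * q).
  by apply: mean_le_eq eq => w; rewrite [in RHS]enormZ exprMn real_normK ?num_real.
have mW := measurable_rVZ (1 - eta t) (measurable_rV_average (@adapted_err t)).
have := mean_le_add_noise n%:R^-1 (index_enum_uniq _) mW eq'.
apply: mean_le_eq => w; congr (enorm _ ^+ 2).
rewrite -averageZ -scaler_sumr -/(average (fun i => noise t i w (xi i t w))).
by rewrite averageD; congr average; apply/funext => i; rewrite err_next.
Qed.

Let mean_le_drift t i :
  mean_le P (fun w => enorm (grd i (x t.+1 w) (xi i t w) - grd i (x t w) (xi i t w)))
    (L i * gam t).
Proof.
have mx := adapted_finer (@before_sub_others t i) (@adapted_x t).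
have mx' := adapted_finer (@before_sub_others t i) (@adapted_xS t).
apply: (mean_le_fresh_sample
  (h := fun q => enorm (grd i (x t.+1 q.1) q.2 - grd i (x t q.1) q.2))
  (b := fun=> L i * gam t)) => //.
- by apply: measurable_enorm; apply: measurable_rVB; exact: measurable_rV_caratheodory.
- by apply: mean_le_cst; rewrite mulr_ge0.
- move=> w.
  have [_ _ h] := mean_le_sample_increment1 (@grd_mean i) (@grd_lip i) (L_ge0 i)
    (x t w) (x t.+1 w).
  by apply: le_trans h _; rewrite lee_fin ler_wpM2l// step_length.
Qed.

Let mean_le_error t i :
  mean_le P (fun w => enorm (grd i (x t w) (xi i t w) - dF i (x t w))) sigma.
Proof.
have mx := adapted_finer (@before_sub_others t i) (@adapted_x t).
apply: (mean_le_fresh_sample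
  (h := fun q => enorm (grd i (x t q.1) q.2 - dF i (x t q.1)))
  (b := fun=> sigma)) => //.
- apply: measurable_enorm; apply: measurable_rVB; first exact: measurable_rV_caratheodory.
  apply: (measurable_rV_comp (X := fun w : g_sigma_algebraType (others t i) => dF i (x t w))).
    exact: continuous_measurable_rV.
  exact: measurable_fst.
- exact: mean_le_cst.
- move=> w.
  by have [_ _ h] := mean_le_sample_error1 (@grd_mean i) (@grd_var i) sigma_ge0 (x t w).
Qed.

Let adapted_input t i : adapted (sampled t) (fun w => v t.+1 w i - g t w i).
Proof.
have [mx mg mv] := adapted_state t.
apply: measurable_rVB.
  exact: (adapted_v_next mx (@adapted_xS t) (mv i)).
exact: adapted_finer (@before_sub_sampled t) (mg i).
Qed.

(** The new gap is C(z) - z at the input z = v_{t+1} - g_t. With z frozen, contractivity bounds the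
    mean square and Jensen's inequality the mean. *)
Lemma mean_le_compressed t i q :
  mean_le P (fun w => enorm (v t.+1 w i - g t w i)) q ->
  mean_le P (fun w => enorm (gap t.+1 i w)) (Num.sqrt (1 - alpha) * q).
Proof.
move=> /(mean_leZ (sqrtr_ge0 (1 - alpha))) rq.
have mZ := @adapted_input t i.
have mk : measurable_fun setT
    (fun q : (g_sigma_algebraType (sampled t) * K i t)%type =>
      enorm (cmp i t q.2 (v t.+1 q.1 i - g t q.1 i) - (v t.+1 q.1 i - g t q.1 i))).
  have mZ1 : measurable_rV (fun q : (g_sigma_algebraType (sampled t) * K i t)%type =>
      v t.+1 q.1 i - g t q.1 i).
    by apply: (measurable_rV_comp mZ); exact: measurable_fst.
  apply: measurable_enorm; apply: measurable_rVB => //.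
  apply: borel_measurable_rV.
  exact: (measurableT_comp (@cmp_meas i t)
    (measurable_fun_pair measurable_snd (measurable_rV_borel mZ1))).
apply: (@mean_le_eq _ _ _ _ (fun w => enorm (cmp i t (kap i t w)
    (v t.+1 w i - g t w i) - (v t.+1 w i - g t w i)))).
  by move=> w; rewrite g_next; congr enorm; apply/rowP => j; rewrite !mxE; ring.
have HI : setI_closed (sampled t) by exact: sigma_algebra_setI_closed.
have HT : sampled t setT by exact: sigma_algebra_setT.
apply: (mean_le_freezing (@sampled_measurable t) HI HT (@fresh_kap t i) mk _ rq).
  by move=> q'; exact: enorm_ge0.
move=> w; set z := v t.+1 w i - g t w i.
have mc : measurable_rV (fun k : K i t => cmp i t k z - z).
  apply: measurable_rVB; last exact: measurable_rV_cst.
  apply: borel_measurable_rV.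
  exact: (measurableT_comp (@cmp_meas i t) (measurable_fun_pair
    (@measurable_id _ _ _) (@measurable_cst _ _ _ (borel_rV R d) setT z))).
have /(_ _ _ _ _)[] // := @mean_le_sqrt _ _ _ (distribution P (kap i t))
  (fun k => enorm (cmp i t k z - z)) (Num.sqrt (1 - alpha) * enorm z).
- exact: measurable_enorm.
- by rewrite mulr_ge0.
rewrite exprMn sqr_sqrtr ?subr_ge0//.
have := contr i t z; rewrite !expectation.unlock; apply: le_trans.
rewrite ge0_integral_distribution//.
- by apply/measurable_EFinP; exact: measurable_enorm_sqr.
- by move=> k; rewrite lee_fin sqr_ge0.
Qed.

(** Before compression, v_{t+1} - g_t is minus the old gap, minus eta_t times the estimation error,
    plus eta_t times the sampling error at x_t, plus the increment of the stochastic gradient. *)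
Lemma mean_le_gap_next t i u m :
  mean_le P (fun w => enorm (gap t i w)) u ->
  mean_le P (fun w => enorm (err t i w)) m ->
  mean_le P (fun w => enorm (gap t.+1 i w))
    (Num.sqrt (1 - alpha) * (u + (eta t * m + (eta t * sigma + L i * gam t)))).
Proof.
move=> hu hm; apply: mean_le_compressed.
have /andP[eta0 _] := eta01 t.
have mZ : measurable_rV (fun w => v t.+1 w i - g t w i).
  exact: adapted_measurable (@sampled_measurable t) (@adapted_input t i).
have := mean_leD hu (mean_leD (mean_leZ eta0 hm)
  (mean_leD (mean_leZ eta0 (@mean_le_error t i)) (@mean_le_drift t i))).
apply: mean_le_mono => //; first exact: measurable_enorm.
move=> w; set A := grd i (x t w) (xi i t w).
have -> : v t.+1 w i - g t w i = (- gap t i w) + (- (eta t *: err t i w) +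
    (eta t *: (A - dF i (x t w)) + (grd i (x t.+1 w) (xi i t w) - A))).
  by rewrite v_next; apply/rowP => j; rewrite !mxE; ring.
rewrite -[X in X * enorm (err _ _ _)]ger0_norm// -enormZ.
rewrite -[X in X * enorm (A - _)]ger0_norm// -enormZ.
rewrite -(enormN (gap t i w)) -(enormN (eta t *: err t i w)).
do 2 (apply: le_trans (ler_enormD _ _) _; rewrite lerD2l).
exact: ler_enormD.
Qed.

(** * Rates under the schedule *)

Variable gamma0 : R.
Hypothesis gamma0_gt0 : 0 < gamma0.
Hypothesis etaE : forall t, eta t = eta_sched t.
Hypothesis gamE : forall t, gam t = gamma0 * eta_sched t.
Hypothesis n_gt0 : (0 < n)%N.

Let c_var i : R := 2 * (sigma ^+ 2 + L i ^+ 2 * gamma0 ^+ 2).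

Let c_var_ge0 i : 0 <= c_var i.
Proof.
have := sqr_ge0 sigma; have := sqr_ge0 (L i * gamma0).
rewrite /c_var exprMn; lra.
Qed.

Let noise_varE t i : noise_var t i = c_var i * eta_sched t ^+ 2.
Proof. by rewrite /noise_var /c_var etaE gamE; ring. Qed.

(** The first step multiplies q0 by (1 - eta_0)^2 = 0, so from index 1 on the bound is free of the
    initial error; afterwards [eta_sched_rec] closes the induction. *)
Lemma mvr_recursion (X : nat -> Omega -> R) c q0 : 0 <= c ->
  mean_le P (X 0) q0 ->
  (forall t q, mean_le P (X t) q ->
    mean_le P (X t.+1) ((1 - eta_sched t) ^+ 2 * q + c * eta_sched t ^+ 2)) ->
  forall t, mean_le P (X t.+1) (2 * c * eta_sched t.+1).
Proof.
move=> c0 X0 XS; elim=> [|t IH]; apply: mean_le_trans (XS _ _ _) _.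
- exact: X0.
- rewrite eta_sched0 subrr expr0n mul0r add0r expr1n mulr1.
  by rewrite [leRHS](_ : _ = c * (2 * eta_sched 1)) ?ler_peMr ?eta_sched1_ge//; ring.
- exact: IH.
- rewrite (_ : _ + _ = c * ((1 - eta_sched t.+1) ^+ 2 * (2 * eta_sched t.+1)
    + eta_sched t.+1 ^+ 2)); last by ring.
  rewrite [leRHS](_ : _ = c * (2 * eta_sched t.+2)); last by ring.
  by rewrite ler_wpM2l// eta_sched_rec.
Qed.

Lemma mean_le_err_sqr t i :
  mean_le P (fun w => enorm (err t.+1 i w) ^+ 2) (2 * c_var i * eta_sched t.+1).
Proof.
apply: (@mvr_recursion (fun t w => enorm (err t i w) ^+ 2)
  (c_var i) (enorm (v0 i - dF i x0) ^+ 2)) => //.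
  by apply: (@mean_le_cst _ _ _ P (enorm (v0 i - dF i x0) ^+ 2)); exact: sqr_ge0.
by move=> s q /mean_le_err_next; rewrite noise_varE etaE.
Qed.

Let Lbar : R := n%:R^-1 * \sum_i L i.

Let Lbar_ge0 : 0 <= Lbar.
Proof. by rewrite mulr_ge0 ?invr_ge0// sumr_ge0. Qed.

Let e_rate : R := 2 * (sigma / Num.sqrt n%:R + Lbar * gamma0).

(** The averaged variance constant is 2 (sigma^2 / n + gamma0^2 sum_i L_i^2 / n^2). Since the L_i
    are nonnegative, sum_i L_i^2 <= (sum_i L_i)^2, so twice this constant is at most [e_rate]
    squared. *)
Lemma mean_le_avg_err t : mean_le P (fun w => enorm (average (fun i => err t.+1 i w)))
  (Num.sqrt (eta_sched t.+1) * e_rate).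
Proof.
have n0 : 0 < n%:R :> R by rewrite ltr0n.
have L2 : \sum_i L i ^+ 2 <= (\sum_i L i) ^+ 2.
  elim: (index_enum _) => [|i s IH]; first by rewrite !big_nil expr0n.
  rewrite !big_cons sqrrD -addrA lerD2l; apply: le_trans IH _.
  by rewrite lerDr mulrn_wge0// mulr_ge0// sumr_ge0.
have h := @mvr_recursion (fun t w => enorm (average (fun i => err t i w)) ^+ 2)
  (n%:R^-1 ^+ 2 * \sum_i c_var i)
  (enorm (average (fun i => v0 i - dF i x0)) ^+ 2).
have [] := h _ _ _ t.
- by rewrite mulr_ge0 ?sqr_ge0// sumr_ge0.
- apply: (@mean_le_cst _ _ _ P (enorm (average (fun i => v0 i - dF i x0)) ^+ 2)).
  exact: sqr_ge0.
- move=> s q /mean_le_avg_err_next; rewrite etaE.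
  under eq_bigr do rewrite noise_varE.
  by rewrite -mulr_suml mulrA.
move=> _ _ Eq; apply: mean_le_sqrt => //.
- apply: measurable_enorm; apply: measurable_rV_average => i.
  exact: adapted_measurable (@before_measurable _) (@adapted_err t.+1 i).
- by rewrite mulr_ge0// mulr_ge0// addr_ge0 ?divr_ge0// mulr_ge0// ltW.
apply: le_trans Eq _; rewrite lee_fin exprMn sqr_sqrtr ?eta_sched_ge0//.
rewrite mulrC ler_wpM2l ?eta_sched_ge0// /e_rate exprMn.
have Lb : n%:R^-1 ^+ 2 * \sum_i L i ^+ 2 <= Lbar ^+ 2.
  by rewrite /Lbar exprMn ler_wpM2l ?sqr_ge0.
have sn : n%:R^-1 ^+ 2 * \sum_(i < n) sigma ^+ 2 = (sigma / Num.sqrt n%:R) ^+ 2.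
  rewrite expr_div_n sqr_sqrtr ?ler0n// sumr_const card_ord -[_ *+ n]mulr_natr.
  by field; rewrite gt_eqF.
have -> : n%:R^-1 ^+ 2 * \sum_i c_var i = 2 * (n%:R^-1 ^+ 2 * (\sum_(i < n) sigma ^+ 2)
    + n%:R^-1 ^+ 2 * (\sum_i L i ^+ 2) * gamma0 ^+ 2).
  rewrite /c_var -mulr_sumr big_split/=.
  by rewrite -[X in _ + X](mulr_suml _ _ _ (gamma0 ^+ 2)); ring.
rewrite sn.
have : n%:R^-1 ^+ 2 * (\sum_i L i ^+ 2) * gamma0 ^+ 2 <= (Lbar * gamma0) ^+ 2.
  by rewrite exprMn ler_wpM2r// sqr_ge0.
have : 0 <= (sigma / Num.sqrt n%:R) * (Lbar * gamma0).
  by rewrite mulr_ge0 ?divr_ge0// mulr_ge0// ltW.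
rewrite sqrrD; lra.
Qed.

(** The factor sqrt(eta_t) is dropped: in the gap recursion this error is already multiplied by
    eta_t, which matches the order of the drift. Index 0 keeps the initial error. *)
Let err_bound i t : R :=
  if t is 0 then enorm (v0 i - dF i x0) else 2 * (sigma + L i * gamma0).

Let err_bound_ge0 i t : 0 <= err_bound i t.
Proof.
by case: t => [|t] /=; rewrite ?enorm_ge0// mulr_ge0// addr_ge0// mulr_ge0// ltW.
Qed.

Lemma mean_le_err t i : mean_le P (fun w => enorm (err t i w)) (err_bound i t).
Proof.
case: t => [|t].
  by apply: (@mean_le_cst _ _ _ P (enorm (v0 i - dF i x0))); exact: enorm_ge0.
have [_ _ Eq] := mean_le_err_sqr t i.
apply: mean_le_sqrt => //.
  apply: measurable_enorm.
  exact: adapted_measurable (@before_measurable _) (@adapted_err t.+1 i).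
apply: le_trans Eq _; rewrite lee_fin /= /c_var.
have Lg : 0 <= sigma * (L i * gamma0) by rewrite !mulr_ge0// ltW.
apply: (@le_trans _ _ (2 * (2 * (sigma ^+ 2 + L i ^+ 2 * gamma0 ^+ 2)) * 1)).
  rewrite ler_wpM2l ?eta_sched_le1// mulr_ge0// mulr_ge0//.
  by rewrite addr_ge0 ?sqr_ge0// mulr_ge0 ?sqr_ge0.
by rewrite mulr1; lra.
Qed.

Let r := Num.sqrt (1 - alpha).
(** Bound on the one-step drift of v_i, divided by eta_t. *)
Let drift i t : R := err_bound i t + (sigma + L i * gamma0).

Let drift_ge0 i t : 0 <= drift i t.
Proof. by rewrite addr_ge0// addr_ge0// mulr_ge0// ltW. Qed.

Let gap_b i t : R :=
  gap_bound r (enorm (g0 i - v0 i)) (fun t => eta_sched t * drift i t) t.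

Lemma mean_le_gap t i : mean_le P (fun w => enorm (gap t i w)) (gap_b i t).
Proof.
elim: t => [|t IH].
  by apply: (@mean_le_cst _ _ _ P (enorm (g0 i - v0 i))); exact: enorm_ge0.
have := mean_le_gap_next IH (mean_le_err t i).
move/mean_le_trans; apply; rewrite le_eqVlt; apply/orP; left; apply/eqP.
by rewrite /gap_b /= -/r /drift etaE gamE; ring.
Qed.

(** * Summing the descent along the run *)

Variable f : 'rV[R]_d -> R.
Variable Lf : R.
Hypothesis f_diff : forall u : 'rV[R]_d, differentiable f u.
Hypothesis f_grad : forall u, grad f u = average (fun i => dF i u).
Hypothesis f_lb : has_lbound (range f).
Hypothesis Lf_ge0 : 0 <= Lf.
Hypothesis f_lip : forall u u', enorm (grad f u - grad f u') <= Lf * enorm (u - u').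

(** The direction error is the average of estimation errors plus gaps. The estimation errors are
    averaged inside the norm, to keep the gain in n; the gaps are averaged outside. *)
Lemma f_step t w : gam t * enorm (grad f (x t w)) <=
  f (x t w) - f (x t.+1 w) + 2 * gam t * (enorm (average (fun i => err t i w))
    + n%:R^-1 * \sum_i enorm (gap t i w)) + Lf * gam t ^+ 2.
Proof.
have := descent_normalized f_diff Lf_ge0 f_lip (x t w) (average (g t w)) (gam_ge0 t).
rewrite -x_next.
have : 2 * gam t * enorm (grad f (x t w) - average (g t w)) <=
  2 * gam t * (enorm (average (fun i => err t i w))
    + n%:R^-1 * \sum_i enorm (gap t i w)).
  rewrite ler_wpM2l ?mulr_ge0// enormB f_grad averageB.
  apply: le_trans (lerD (lexx _) (enorm_average _)).
  apply: le_trans (ler_enormD _ _); rewrite averageD.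
  rewrite le_eqVlt; apply/orP; left; apply/eqP; congr (enorm (average _)).
  by apply/funext => i; rewrite [RHS]addrC subrKA.
lra.
Qed.

Let slack t w : R := 2 * gam t * (enorm (average (fun i => err t i w))
    + n%:R^-1 * \sum_i enorm (gap t i w)).

(** Descent is summed from x_1 on. Leaving x_0 in any direction of length at most gam_0 raises f by
    at most gam_0 |grad f(x_0)| + Lf gam_0^2. With the summand t = 0, the quantity gam_0 |grad
    f(x_0)| occurs twice, each time bounded by [grad_le_gap]; this makes the two factors 3. *)
Lemma f_telescope T w :
  \sum_(t < T.+1) gam t * enorm (grad f (x t w)) <=
    3 * (f x0 - inf (range f)) + 3 * (Lf * gam 0 ^+ 2) +
    (\sum_(t < T) slack t.+1 w + Lf * \sum_(t < T) gam t.+1 ^+ 2).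
Proof.
have f1 : f (x 1 w) <= f x0 + gam 0 * enorm (grad f x0) + Lf * gam 0 ^+ 2.
  have sl := step_length 0 w.
  have := descent_quadratic f_diff Lf_ge0 f_lip x0 (x 1 w - x0).
  rewrite addrC subrK => /le_trans; apply; apply: lerD.
    rewrite lerD2l; apply: le_trans (dot_le_enorm _ _) _.
    by rewrite mulrC ler_wpM2r.
  by rewrite ler_wpM2l// lerXn2r// ?nnegrE.
have g1 := grad_le_gap f_diff Lf_ge0 f_lip x0 f_lb (gam_ge0 0).
have fT : inf (range f) <= f (x T.+1 w).
  by apply: inf_lbound => //; exists (x T.+1 w).
rewrite big_ord_recl; under eq_bigr do rewrite lift0.
suff : \sum_(t < T) gam t.+1 * enorm (grad f (x t.+1 w)) <=
  f (x 1 w) - f (x T.+1 w) +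
    (\sum_(t < T) slack t.+1 w + Lf * \sum_(t < T) gam t.+1 ^+ 2).
  by move: f1 g1 fT; rewrite (_ : x ord0 w = x0)//; lra.
elim: T {fT} => [|T IH]; first by rewrite !big_ord0 mulr0; lra.
rewrite 3!big_ord_recr; change (nat_of_ord ord_max) with T.
have := f_step T.+1 w; rewrite -/(slack _ _); move: IH.
move: (\sum_(t < T) _) (\sum_(t < T) _) (\sum_(t < T) _) => A B C /=; lra.
Qed.

Lemma mean_le_weighted T :
  mean_le P (fun w => \sum_(t < T.+1) gam t * enorm (grad f (x t w)))
   (3 * (f x0 - inf (range f)) + 3 * (Lf * gam 0 ^+ 2) +
    (\sum_(t < T) 2 * gam t.+1 * (Num.sqrt (eta_sched t.+1) * e_rate
        + n%:R^-1 * \sum_i gap_b i t.+1) +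
     Lf * \sum_(t < T) gam t.+1 ^+ 2)).
Proof.
have mx t : measurable_rV (x t).
  exact: adapted_measurable (@before_measurable t) (@adapted_x t).
have D0 : 0 <= f x0 - inf (range f).
  by rewrite subr_ge0; apply: inf_lbound => //; exists x0.
apply: mean_le_mono (@f_telescope T) _.
- apply: measurable_sum => t; apply: measurable_funM => //.
  apply: measurable_enorm.
  rewrite (_ : (fun w => _) = fun w => average (fun i => dF i (x t w))); last first.
    by apply/funext => w; rewrite f_grad.
  by apply: measurable_rV_average => i; exact: continuous_measurable_rV.
- by move=> w; apply: sumr_ge0 => t _; rewrite mulr_ge0.
apply: mean_leD.
  by apply: mean_le_cst; rewrite addr_ge0// ?mulr_ge0// ?sqr_ge0// mulr_ge0// sqr_ge0.
apply: mean_leD; last first.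
  by apply: mean_le_cst; rewrite mulr_ge0// sumr_ge0// => t _; exact: sqr_ge0.
apply: mean_le_sum => t; apply: mean_leZ; first by rewrite mulr_ge0.
apply: mean_leD; first exact: mean_le_avg_err.
apply: mean_leZ; first by rewrite invr_ge0.
by apply: mean_le_sum => i; exact: mean_le_gap.
Qed.


Let gap_avg := n%:R^-1 * \sum_i enorm (g0 i - v0 i).
Let err_avg := n%:R^-1 * \sum_i enorm (v0 i - dF i x0).
Hypothesis alpha_gt0 : 0 < alpha.

Let r_ge0 : 0 <= r. Proof. exact: sqrtr_ge0. Qed.

Let r_le : alpha / 2 <= 1 - r.
Proof.
suff h : r <= 1 - alpha / 2 by lra.
have a2 : 0 <= 1 - alpha / 2 by move: alpha_le1; lra.
rewrite -(@ler_pXn2r _ 2)// ?nnegrE//.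
rewrite sqr_sqrtr ?subr_ge0//.
by have := sqr_ge0 (alpha / 2); lra.
Qed.

Let r_lt1 : 0 < 1 - r. Proof. by apply: lt_le_trans r_le; rewrite divr_gt0. Qed.

(** From r <= 1 and alpha^2 <= alpha <= 2 (1 - r). *)
Let contraction_le : r / (1 - r) <= 2 / alpha ^+ 2.
Proof.
rewrite ler_pdivrMr// mulrAC ler_pdivlMr ?exprn_gt0//.
have r1 : r <= 1 by rewrite -subr_ge0 ltW.
have a1 : alpha ^+ 2 <= alpha by rewrite expr2 ler_piMr// ltW.
apply: (@le_trans _ _ (1 * alpha)); last first.
  by rewrite mul1r mulrC -ler_pdivrMr.
by apply: ler_pM => //; exact: sqr_ge0.
Qed.

(** With s = sigma + L_i gamma0, the drift is 3 s at t >= 1, and at t = 0 it is the initial error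
    plus s. Since eta_t^2 <= 2/(t+2), the harmonic sum turns 3 s into 6 s times the logarithm. *)
Lemma sum_gap_b_le T i :
  \sum_(t < T) eta_sched t.+1 * gap_b i t.+1 <=
  (enorm (g0 i - v0 i) + r * enorm (v0 i - dF i x0)) / (1 - r)
  + r / (1 - r) * (6 * ln T.+2%:R * (sigma + L i * gamma0)).
Proof.
set s := sigma + L i * gamma0.
have s0 : 0 <= s by rewrite addr_ge0// mulr_ge0// ltW.
have gb0 t : 0 <= gap_b i t.
  by apply: gap_bound_ge0 => // k; rewrite mulr_ge0// eta_sched_ge0.
have sumT : \sum_(t < T.+1) eta_sched t ^+ 2 * drift i t <=
    enorm (v0 i - dF i x0) + 6 * ln T.+2%:R * s.
  apply: (@le_trans _ _ (enorm (v0 i - dF i x0) + 3 * s * \sum_(t < T.+1) 2 / t.+2%:R));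
    last first.
    have := @sum_harmonic_le R T.+1; rewrite lerD2l => h.
    rewrite [leRHS](_ : _ = 3 * s * (2 * ln T.+2%:R)); last by ring.
    by rewrite ler_wpM2l// mulr_ge0.
  rewrite big_ord_recl [in leRHS]big_ord_recl eta_sched0 expr1n mul1r.
  rewrite mulrDr addrA; apply: lerD.
    by rewrite /drift /= -/s lerD2l divff// mulr1; lra.
  rewrite mulr_sumr; apply: ler_sum => t _; rewrite lift0 /drift/= -/s.
  rewrite mulrC (_ : 2 * s + s = 3 * s); last by ring.
  by rewrite ler_wpM2l ?mulr_ge0// eta_sched_sqr_le.
have := @sum_gap_bound_le _ r (enorm (g0 i - v0 i)) (drift i) T.+1 r_ge0
  (enorm_ge0 _) (@drift_ge0 i).
rewrite -/(gap_b i) => h.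
have : \sum_(t < T) eta_sched t.+1 * gap_b i t.+1 <=
    \sum_(t < T.+1) eta_sched t * gap_b i t.
  rewrite big_ord_recl; under [X in _ <= _ + X]eq_bigr do rewrite lift0.
  by rewrite lerDr mulr_ge0 ?gb0// eta_sched_ge0.
move/le_trans; apply; rewrite mulrAC -mulrDl ler_pdivlMr// mulrC.
apply: le_trans h _; rewrite -addrA -mulrDr lerD2l ler_wpM2l//.
Qed.

(** Three sums are collected: eta^(3/2) carries the averaged error ([S1]), eta times the gap the
    compression error ([S2]), and eta^2 the curvature term ([S3]). Each is at most a constant plus a
    multiple of l. *)
Lemma weighted_bound_le T :
  3 * (f x0 - inf (range f)) + 3 * (Lf * gam 0 ^+ 2) +
    (\sum_(t < T) 2 * gam t.+1 * (Num.sqrt (eta_sched t.+1) * e_rate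
        + n%:R^-1 * \sum_i gap_b i t.+1) +
     Lf * \sum_(t < T) gam t.+1 ^+ 2) <=
  gamma0 * (24 * (1 + ln T.+2%:R) *
    ((f x0 - inf (range f) + 2 * gamma0 / (1 - r) * gap_avg
        + 2 * gamma0 * r / (1 - r) * err_avg) / gamma0
     + sigma * (1 / Num.sqrt n%:R + 1 / alpha ^+ 2)
     + gamma0 * (Lf + Lbar + Lbar / alpha ^+ 2))).
Proof.
have g00 := ltW gamma0_gt0.
set l := ln T.+2%:R.
have l0 : 0 <= l by rewrite ln_ge0// ler1n.
have shift (u : nat -> R) : (forall t, 0 <= u t) ->
    \sum_(t < T) u t.+1 <= \sum_(t < T.+1) u t.
  move=> u0; rewrite big_ord_recl; under [X in _ <= _ + X]eq_bigr do rewrite lift0.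
  by rewrite lerDr.
have harm (u : nat -> R) : (forall t, 0 <= u t) -> (forall t, u t <= 2 / t.+2%:R) ->
    \sum_(t < T) u t.+1 <= 2 * l.
  move=> u0 uh; apply: le_trans (shift _ u0) _.
  apply: le_trans (sum_harmonic_le T.+1).
  by apply: ler_sum => t _; exact: uh.
have S1 : \sum_(t < T) eta_sched t.+1 * Num.sqrt (eta_sched t.+1) <= 2 * l.
  apply: (harm (fun t => eta_sched t * Num.sqrt (eta_sched t))) => t.
    by rewrite mulr_ge0 ?eta_sched_ge0 ?sqrtr_ge0.
  by rewrite eta_sched_sqrt.
have S3 : \sum_(t < T) gam t.+1 ^+ 2 <= gamma0 ^+ 2 * (2 * l).
  under eq_bigr do rewrite gamE exprMn.
  rewrite -mulr_sumr ler_wpM2l ?sqr_ge0//.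
  apply: (harm (fun t => eta_sched t ^+ 2)) => t; first exact: sqr_ge0.
  exact: eta_sched_sqr_le.
have e_rate0 : 0 <= e_rate.
  by rewrite mulr_ge0// addr_ge0 ?divr_ge0 ?sqrtr_ge0// mulr_ge0.
have S2 : n%:R^-1 * \sum_i \sum_(t < T) eta_sched t.+1 * gap_b i t.+1 <=
    (gap_avg + r * err_avg) / (1 - r)
    + r / (1 - r) * (6 * l * (sigma + Lbar * gamma0)).
  apply: (@le_trans _ _ (n%:R^-1 * \sum_i
      ((enorm (g0 i - v0 i) + r * enorm (v0 i - dF i x0)) / (1 - r)
      + r / (1 - r) * (6 * l * (sigma + L i * gamma0))))).
    rewrite ler_wpM2l ?invr_ge0//; apply: ler_sum => i _; exact: sum_gap_b_le.
  rewrite le_eqVlt; apply/orP; left; apply/eqP.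
  rewrite big_split/= -mulr_suml big_split/= -mulr_sumr -mulr_sumr -mulr_sumr.
  rewrite big_split/= -mulr_suml sumr_const card_ord -[_ *+ n]mulr_natr.
  rewrite /gap_avg /err_avg /Lbar; field.
  by rewrite pnatr_eq0 -lt0n n_gt0/= gt_eqF.
have -> : \sum_(t < T) 2 * gam t.+1 * (Num.sqrt (eta_sched t.+1) * e_rate
        + n%:R^-1 * \sum_i gap_b i t.+1) =
    2 * gamma0 * (e_rate * \sum_(t < T) eta_sched t.+1 * Num.sqrt (eta_sched t.+1)
      + n%:R^-1 * \sum_i \sum_(t < T) eta_sched t.+1 * gap_b i t.+1).
  rewrite exchange_big/=; under [X in _ + n%:R^-1 * X]eq_bigr do rewrite -mulr_sumr.
  rewrite [e_rate * _]mulr_sumr [n%:R^-1 * \sum_(t < T) _]mulr_sumr.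
  rewrite -big_split/= mulr_sumr.
  by apply: eq_bigr => t _; rewrite gamE; ring.
have Sg : 2 * gamma0 * (e_rate * \sum_(t < T) eta_sched t.+1 * Num.sqrt (eta_sched t.+1)
      + n%:R^-1 * \sum_i \sum_(t < T) eta_sched t.+1 * gap_b i t.+1) <=
    2 * gamma0 * (e_rate * (2 * l) + ((gap_avg + r * err_avg) / (1 - r)
    + r / (1 - r) * (6 * l * (sigma + Lbar * gamma0)))).
  by rewrite ler_wpM2l ?mulr_ge0// lerD// ler_wpM2l.
have SL : Lf * \sum_(t < T) gam t.+1 ^+ 2 <= Lf * (gamma0 ^+ 2 * (2 * l)).
  by rewrite ler_wpM2l.
have D0 : 0 <= f x0 - inf (range f).
  by rewrite subr_ge0; apply: inf_lbound => //; exists x0.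
move: Sg SL; rewrite [gam 0]gamE eta_sched0 mulr1.
set X1 := 2 * gamma0 * _; set X2 := Lf * _ => Sg SL.
apply: (@le_trans _ _ (3 * (f x0 - inf (range f)) + 3 * (Lf * gamma0 ^+ 2) +
  (2 * gamma0 * (e_rate * (2 * l) + ((gap_avg + r * err_avg) / (1 - r)
    + r / (1 - r) * (6 * l * (sigma + Lbar * gamma0))))
  + Lf * (gamma0 ^+ 2 * (2 * l))))); first by rewrite lerD2l lerD.
have k0 : 0 <= r / (1 - r) by rewrite divr_ge0// ltW.
set p1 := f x0 - inf (range f) in D0 *.
pose p2 := gamma0 / (1 - r) * gap_avg.
pose p3 := gamma0 * r / (1 - r) * err_avg.
pose p4 := gamma0 * (sigma / Num.sqrt n%:R).
pose p5 := gamma0 * sigma / alpha ^+ 2.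
pose p6 := gamma0 ^+ 2 * Lf.
pose p7 := gamma0 ^+ 2 * Lbar.
pose p8 := gamma0 ^+ 2 * Lbar / alpha ^+ 2.
pose q5 := gamma0 * sigma * (r / (1 - r)).
pose q8 := gamma0 ^+ 2 * Lbar * (r / (1 - r)).
have i0 : 0 <= (1 - r)^-1 by rewrite invr_ge0 ltW.
have av0 (u : 'I_n -> 'rV[R]_d) : 0 <= n%:R^-1 * \sum_i enorm (u i).
  by rewrite mulr_ge0 ?invr_ge0// sumr_ge0.
have p20 : 0 <= p2 by rewrite mulr_ge0 ?av0// mulr_ge0.
have p30 : 0 <= p3 by rewrite mulr_ge0 ?av0// mulr_ge0// mulr_ge0.
have p40 : 0 <= p4 by rewrite mulr_ge0// divr_ge0// sqrtr_ge0.
have p50 : 0 <= p5 by rewrite divr_ge0 ?sqr_ge0// mulr_ge0.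
have p60 : 0 <= p6 by rewrite mulr_ge0 ?sqr_ge0.
have p70 : 0 <= p7 by rewrite mulr_ge0 ?sqr_ge0.
have p80 : 0 <= p8 by rewrite divr_ge0 ?sqr_ge0// mulr_ge0 ?sqr_ge0.
have q5p : q5 <= 2 * p5.
  rewrite /q5 (_ : 2 * p5 = gamma0 * sigma * (2 / alpha ^+ 2)); last by rewrite /p5; ring.
  by rewrite ler_wpM2l// mulr_ge0.
have q8p : q8 <= 2 * p8.
  rewrite /q8 (_ : 2 * p8 = gamma0 ^+ 2 * Lbar * (2 / alpha ^+ 2)); last by rewrite /p8; ring.
  by rewrite ler_wpM2l// mulr_ge0 ?sqr_ge0.
have -> : 3 * p1 + 3 * (Lf * gamma0 ^+ 2) +
  (2 * gamma0 * (e_rate * (2 * l) + ((gap_avg + r * err_avg) / (1 - r)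
    + r / (1 - r) * (6 * l * (sigma + Lbar * gamma0))))
  + Lf * (gamma0 ^+ 2 * (2 * l))) =
  3 * p1 + 3 * p6 + 8 * (l * (p4 + p7)) + 2 * p2 + 2 * p3
    + 12 * (l * (q5 + q8)) + 2 * (l * p6).
  by rewrite /e_rate /p2 /p3 /p4 /p6 /p7 /q5 /q8; ring.
rewrite [leRHS](_ : _ = 24 * ((p1 + 2 * p2 + 2 * p3 + p4 + p5 + p6 + p7 + p8)
    + l * (p1 + 2 * p2 + 2 * p3 + p4 + p5 + p6 + p7 + p8))); last first.
  rewrite /p2 /p3 /p4 /p5 /p6 /p7 /p8.
  have gn : gamma0 != 0 by rewrite gt_eqF.
  have -> : (p1 + 2 * gamma0 / (1 - r) * gap_avg + 2 * gamma0 * r / (1 - r) * err_avg)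
    / gamma0 = p1 / gamma0 + 2 * ((1 - r)^-1 * gap_avg) + 2 * (r / (1 - r) * err_avg).
    by field; rewrite gn gt_eqF.
  have -> : p1 = gamma0 * (p1 / gamma0) by rewrite mulrCA divff// mulr1.
  rewrite [gamma0 * (p1 / gamma0) / gamma0]mulrAC divff// mul1r.
  by ring.
exact: weighted_arith.
Qed.

End run.

(** * Evaluation at the random output index *)

Section random_index.
Context {R : realType} {dO : measure_display} {Omega : measurableType dO}.
Variable P : probability Omega R.
Variable tau : {RV P >-> nat}.
Variable H : set (set Omega).
Hypothesis mH : H `<=` measurable.
Hypothesis HI : setI_closed H.
Hypothesis HT : H setT.
Hypothesis indH : indep2 P (sigma_gen tau) H.
Variables (T : nat) (p : nat -> R) (h : nat -> Omega -> R).
Hypothesis tau_p : forall t, (t < T)%N -> P (tau @^-1` [set t]) = (p t)%:E.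
Hypothesis p_sum : \sum_(t < T) p t = 1.
Hypothesis h_ge0 : forall t w, 0 <= h t w.
Hypothesis mh : forall t, measurable_fun setT (h t).
Hypothesis mhH : forall t, (t < T)%N ->
  measurable_fun setT (h t : g_sigma_algebraType H -> R).

Let mtau (B : set nat) : measurable (tau @^-1` B).
Proof. by rewrite -[X in measurable X]setTI; exact: (measurable_funP tau). Qed.

Let measurable_select : measurable_fun setT (fun w => h (tau w) w).
Proof.
move=> _ B mB; rewrite setTI.
rewrite [X in measurable X](_ : _ =
    \bigcup_t (tau @^-1` [set t] `&` h t @^-1` B)).
  apply: bigcupT_measurable => t; apply: measurableI => //.
  by have := mh t measurableT mB; rewrite setTI.
by apply/seteqP; split => [w /= hB|w [t _ [/= <-]]//]; exists (tau w).
Qed.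

(** The law of [tau] is prescribed only below T, but these probabilities already sum to 1. *)
Let tau_lt : {ae P, forall w, (tau w < T)%N}.
Proof.
exists (tau @^-1` [set k | ~~ (k < T)%N]); split => //; last by move=> w /negP.
have tauT : P (tau @^-1` [set k | (k < T)%N]) = 1%E.
  pose A (t : nat) := tau @^-1` [set t].
  have tA : trivIset setT A.
    by move=> i j _ _ [w []]; rewrite /A/= => <- <-.
  rewrite (_ : tau @^-1` _ = \big[setU/set0]_(t < T) A t); last first.
    rewrite -bigcup_mkord; apply/seteqP; split => [w /= wT|w [t /= tT]].
      by exists (tau w).
    by rewrite /A/= => ->.
  have mA t : measurable (A t) by exact: mtau.
  transitivity (\sum_(t < T) P (A t))%E; first by rewrite measure_bigsetU.
  transitivity (\sum_(t < T) (p t)%:E)%E; last by rewrite sumEFin p_sum.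
  by apply: eq_bigr => t _; exact: tau_p.
have -> : tau @^-1` [set k | ~~ (k < T)%N] = ~` (tau @^-1` [set k | (k < T)%N]).
  by apply/seteqP; split => w /= /negP.
by rewrite probability_setC// tauT subee.
Qed.

(** [F] selects among the indices below T only, since just these [h t] are known to be
    [H]-measurable. With the past frozen, integrating [tau] gives the weighted sum; almost surely
    tau < T, so [F] dominates the selected value. *)
Lemma mean_random_index a :
  mean_le P (fun w => \sum_(t < T) p t * h t w) a ->
  ('E_P[fun w => h (tau w) w] <= a%:E)%E.
Proof.
move=> ha.
have mi (t : nat) : measurable_fun setT (fun k : nat => (k == t)%:R : R) by [].
pose F (q : (g_sigma_algebraType H * nat)%type) : R :=
  \sum_(t < T) (q.2 == t)%:R * h t q.1.
have mF : measurable_fun setT F.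
  apply: measurable_sum => t; apply: measurable_funM.
    exact: (measurableT_comp (mi t) measurable_snd).
  exact: (measurableT_comp (mhH (ltn_ord t)) measurable_fst).
have F0 q : 0 <= F q by apply: sumr_ge0 => t _; rewrite mulr_ge0.
have [mY Y0 Ya] : mean_le P (fun w => F (w, tau w)) a.
  apply: (mean_le_freezing mH HI HT indH mF F0 ha) => w.
  suff [] : mean_le (distribution P tau) (fun k => F (w, k))
      (\sum_(t < T) p t * h t w) by [].
  apply: mean_le_sum => t.
  apply: (@mean_le_eq _ _ _ _ (fun k : nat => h t w * (k == t)%:R)).
    by move=> k; rewrite mulrC.
  rewrite mulrC; apply: mean_leZ => //; split => //.
  rewrite (_ : (fun k : nat => _) = \1_[set nat_of_ord t]); last first.
    apply/funext => k; rewrite indicE.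
    by case: eqP => [->|kt]; [rewrite mem_set|rewrite memNset].
  by rewrite expectation_indic// -tau_p.
apply: le_trans Ya; apply: expectation_le => //.
apply: filterS tau_lt => w wT.
rewrite /F (bigD1 (Ordinal wT))//= eqxx mul1r lerDl.
by apply: sumr_ge0 => t _; rewrite mulr_ge0.
Qed.

End random_index.

(** * Gradient of the averaged objective *)

Section average_of_functions.
Context {R : realType} {d n : nat}.
Variable fi : 'I_n -> 'rV[R]_d -> R.
Hypothesis fi_diff : forall i (u : 'rV[R]_d), differentiable (fi i) u.

Let f (u : 'rV[R]_d) : R := n%:R^-1 * \sum_i fi i u.

Let fE : f = n%:R^-1 *: (\sum_(i < n) fi i).
Proof. by apply/funext => u; rewrite /f fctE fct_sumE. Qed.

Lemma differentiable_average (u : 'rV[R]_d) : differentiable f u.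
Proof. by rewrite fE; apply: differentiableZ; exact: differentiable_sum. Qed.

Lemma grad_average u : grad f u = average (fun i => grad (fi i) u).
Proof.
have dv i v : derivable (fi i) u v by exact: diff_derivable.
apply/rowP => j; rewrite !mxE summxE fE deriveZ ?derive_sum//; last first.
  exact: derivable_sum.
by congr (_ * _); apply: eq_bigr => i _; rewrite mxE.
Qed.

End average_of_functions.

(** * Assembly of the rate *)

Theorem theorem5 (R : realType) :
  exists C p : R, 0 < C /\ 0 <= p /\
  forall (d n : nat) (n_gt0 : (0 < n)%N)
    (* the data distributions D_i and the losses F i x xi = f_i(x; xi) *)
    (dX : 'I_n -> measure_display) (Xi : forall i, measurableType (dX i))
    (D : forall i, probability (Xi i) R)
    (F : forall i, 'rV[R]_d -> Xi i -> R)
    (* the probability space, the samples, the compressors *)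
    (dO : measure_display) (Omega : measurableType dO) (P : probability Omega R)
    (xi : forall i, nat -> {RV P >-> Xi i})
    (dK : 'I_n -> nat -> measure_display)
    (K : forall i t, measurableType (dK i t))
    (kap : forall i t, {RV P >-> K i t})
    (cmp : forall i t, K i t -> 'rV[R]_d -> 'rV[R]_d)
    (* parameters and initialization *)
    (alpha L sigma_g sigma_h gamma0 : R) (Lms : 'I_n -> R)
    (x0 : 'rV[R]_d) (g0 v0 : 'I_n -> 'rV[R]_d),
  let fi := fun i x => fine ('E_(D i)[F i x])%E in
  let f := fun x => n%:R^-1 * \sum_i fi i x in
  (* f_i(x) = E[f_i(x; xi_i)] is well defined, and everything is smooth *)
  (forall i x, (D i).-integrable setT (EFin \o F i x)) ->
  (forall i, twice_differentiable (fi i)) ->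
  (forall i z, twice_differentiable (fun x => F i x z)) ->
  (* sampling and compression *)
  (forall i t A, measurable A -> distribution P (xi i t) A = D i A) ->
  fresh_samples P (fun i t => xi i t : Omega -> Xi i)
    (fun i t => kap i t : Omega -> K i t) ->
  (forall i t, measurable_fun setT
     (fun q : K i t * borel_rV R d => cmp i t q.1 q.2 : borel_rV R d)) ->
  fresh_compressors P (fun i t => xi i t : Omega -> Xi i)
    (fun i t => kap i t : Omega -> K i t) ->
  (* (i) *)
  0 < alpha -> alpha <= 1 ->
  (forall i t, contractive P alpha (fun w => cmp i t (kap i t w))) ->
  (* (ii) *)
  has_lbound (range f) ->
  (* (iii) *)
  (forall i, 0 < Lms i) ->
  (forall i x y,
     ('E_(D i)[fun z => (enorm (grad (fun u => F i u z) x
                                - grad (fun u => F i u z) y) ^+ 2)%R]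
      <= (Lms i ^+ 2 * enorm (x - y) ^+ 2)%:E)%E) ->
  (* (iv) *)
  0 < L ->
  (forall x y, enorm (grad f x - grad f y) <= L * enorm (x - y)) ->
  (* (v) *)
  0 <= sigma_g -> 0 <= sigma_h ->
  (forall i x, has_mean (D i) (fun z => grad (fun u => F i u z) x)
                 (grad (fi i) x)) ->
  (forall i x,
     ('E_(D i)[fun z => (enorm (grad (fun u => F i u z) x - grad (fi i) x) ^+ 2)%R]
      <= (sigma_g ^+ 2)%:E)%E) ->
  (forall i x, has_mean (D i) (fun z => hess (fun u => F i u z) x)
                 (hess (fi i) x)) ->
  (forall i x,
     ('E_(D i)[fun z => (specnorm (hess (fun u => F i u z) x
                                   - hess (fi i) x) ^+ 2)%R]
      <= (sigma_h ^+ 2)%:E)%E) ->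
  0 < gamma0 ->
  let gamma := gamma_sched gamma0 in
  let x := fun (t : nat) (w : Omega) =>
    xs (ef21_mvr eta_sched gamma
          (fun s i u => grad (fun y => F i y (xi i s w)) u)
          (fun s i => cmp i s (kap i s w))
          (State x0 g0 v0) t) in
  forall (T : nat) (tau : {RV P >-> nat}),
  (0 < T)%N ->
  (* the random index of the output, independent of the run *)
  (forall t, (t < T)%N ->
     P (tau @^-1` [set t]) = (gamma t / \sum_(s < T) gamma s)%:E) ->
  indep2 P (sigma_gen tau)
    (past (fun i t => xi i t : Omega -> Xi i)
       (fun i t => kap i t : Omega -> K i t) T) ->
  ('E_P[fun w => enorm (grad f (x (tau w) w))]
   <= (C * (1 + ln T.+1%:R) `^ p *
       ((V0_const alpha gamma0 fi f x0 g0 v0 / gamma0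
         + sigma_g * (1 / Num.sqrt n%:R + 1 / alpha ^+ 2)
         + gamma0 * E1_const alpha L Lms)
        / T%:R `^ (1 / 3)))%:E)%E.

Proof.
(* The constant 24 comes from [weighted_bound_le]; a single logarithm is lost. Below, the horizon is
   written [T.+1]. *)
exists 24, 1; split => //; split => // d n n_gt0 dX Xi D F dO Omega P xi dK K kap cmp
  alpha L sigma_g sigma_h gamma0 Lms x0 g0 v0 fi f _ dfi dF distr_xi fresh_xi
  cmp_meas fresh_kap alpha_gt0 alpha_le1 contr f_lb Lms_gt0 grd_lip L_gt0 f_lip
  sigma_ge0 _ grd_mean grd_var _ _ gamma0_gt0 gamma x [//|T] tau _ tau_law tau_indep.
have grd_cont i z : continuous (fun u => grad (fun y => F i y z) u).
  by move=> u; apply: differentiable_continuous; have [] := dF i z u.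
have grd_meas i u : measurable_rV (fun z => grad (fun y => F i y z) u).
  exact: has_mean_measurable (grd_mean i u).
have dfi_cont i : continuous (grad (fi i)).
  by move=> u; apply: differentiable_continuous; have [] := dfi i u.
have fi_diff i (u : 'rV[R]_d) : differentiable (fi i) u by have [] := dfi i u.
have f_diff (u : 'rV[R]_d) : differentiable f u by exact: differentiable_average.
have f_grad u : grad f u = average (fun i => grad (fi i) u) by exact: grad_average.
have gamma_gt0 t : 0 < gamma t by rewrite mulr_gt0// eta_sched_gt0.
have gamma_ge0 t : 0 <= gamma t by exact: ltW.
have eta01 t : 0 <= @eta_sched R t <= 1 by rewrite eta_sched_ge0 eta_sched_le1.
have Lms_ge0 i : 0 <= Lms i by exact: ltW.
pose W := \sum_(s < T.+1) gamma s.
(* The total weight supplies the rate: the factor gamma0 of [weighted_bound_le] is at most W /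
   (T+1)^(1/3). *)
have W_ge : gamma0 * T.+1%:R `^ (1 / 3) <= W.
  rewrite /W /gamma /gamma_sched -mulr_sumr ler_pM2l//.
  exact: sum_eta_sched_ge.
have c_gt0 : 0 < T.+1%:R `^ (1 / 3) :> R by rewrite powR_gt0.
have W_gt0 : 0 < W by apply: lt_le_trans W_ge; rewrite mulr_gt0.
set B := (X in (_ <= X%:E)%E).
have run_bound : mean_le P
    (fun w => \sum_(t < T.+1) gamma t * enorm (grad f (x t w))) (W * B).
  have gammaE t : gamma t = gamma0 * eta_sched t by [].
  have etaE t : eta_sched t = eta_sched t :> R by [].
  have MW := (mean_le_weighted x0 g0 v0
    (grd := fun i u z => grad (fun y => F i y z) u) grd_cont grd_meas cmp_meas
    dfi_cont grd_mean grd_var grd_lip sigma_ge0 Lms_ge0 eta01 gamma_ge0 distr_xi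
    fresh_xi fresh_kap contr alpha_le1 gamma0_gt0 etaE gammaE
    n_gt0 f_diff f_grad f_lb (ltW L_gt0) f_lip T).
  apply: (mean_le_trans MW).
  apply: le_trans (weighted_bound_le x0 g0 v0 (fun i => grad (fi i)) sigma_ge0 Lms_ge0
    alpha_le1 gamma0_gt0 gammaE n_gt0 f_lb (ltW L_gt0) alpha_gt0 T) _.
  have ln0 : 0 <= ln T.+2%:R :> R by rewrite ln_ge0// ler1n.
  rewrite /B powRr1 ?addr_ge0//.
  rewrite /V0_const /E1_const -/f.
  set Q := (X in _ <= W * (24 * _ * (X / _))).
  (* Nonnegativity of the bracket allows gamma0 to be replaced by that larger factor. *)
  have Q0 : 0 <= Q.
    have g00 := ltW gamma0_gt0; have a00 := ltW alpha_gt0.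
    have r1 : 0 <= 1 - Num.sqrt (1 - alpha).
      by rewrite subr_ge0 -[leRHS]sqrtr1 ler_wsqrtr// gerBl.
    have avg0 (u : 'I_n -> R) : (forall i, 0 <= u i) -> 0 <= n%:R^-1 * \sum_i u i.
      by move=> u0; rewrite mulr_ge0 ?invr_ge0// sumr_ge0.
    have D0 : 0 <= f x0 - inf (range f).
      by rewrite subr_ge0; apply: inf_lbound => //; exists x0.
    apply: addr_ge0; [apply: addr_ge0|].
    - apply: divr_ge0 => //; apply: addr_ge0; [apply: addr_ge0 => //|];
        apply: mulr_ge0; do ?[exact: avg0]; apply: divr_ge0 => //.
        exact: mulr_ge0.
      by apply: mulr_ge0; [exact: mulr_ge0|exact: sqrtr_ge0].
    - by rewrite mulr_ge0// addr_ge0// divr_ge0// ?sqrtr_ge0// exprn_ge0.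
    - by rewrite mulr_ge0// !addr_ge0 ?avg0 ?divr_ge0 ?avg0 ?exprn_ge0// ltW.
  rewrite [leRHS](_ : _ = W / T.+1%:R `^ (1 / 3) * (24 * (1 + ln T.+2%:R) * Q)); last first.
    by ring.
  rewrite ler_wpM2r//; first by rewrite !mulr_ge0// addr_ge0.
  by rewrite ler_pdivlMr.
pose p t := gamma t / W.
have p_sum : \sum_(t < T.+1) p t = 1 by rewrite -mulr_suml divff// gt_eqF.
have mx t : adapted (past (fun i t => xi i t : Omega -> Xi i)
    (fun i t => kap i t : Omega -> K i t) t) (x t).
  by have [] := adapted_state xi kap eta_sched gamma x0 g0 v0
    (grd := fun i u z => grad (fun y => F i y z) u) grd_cont grd_meas cmp_meas t.
have pm := @before_measurable _ _ _ _ _ _ P xi _ _ kap.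
have gradE t : (fun w => grad f (x t w)) =
    (fun w => average (fun i => grad (fi i) (x t w))).
  by apply/funext => w; exact: f_grad.
apply: (mean_random_index (pm T.+1) _ _ tau_indep (p := p)
  (h := fun t w => enorm (grad f (x t w))) tau_law p_sum).
- exact: sigma_algebra_setI_closed.
- exact: sigma_algebra_setT.
- by move=> t w; exact: enorm_ge0.
- move=> t; apply: measurable_enorm; rewrite gradE; apply: measurable_rV_average => i.
  exact: continuous_measurable_rV (adapted_measurable (pm t) (mx t)).
- move=> t tT; apply: measurable_enorm; rewrite gradE.
  apply: measurable_rV_average => i; apply: continuous_measurable_rV => //.
  apply: adapted_finer (mx t); apply: before_le; exact: ltnW.
(* Dividing by W turns the weighted sum into the mean over the output index. *)
have := mean_leZ (ltW (etrans (invr_gt0 W) W_gt0)) run_bound.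
rewrite mulKf ?gt_eqF//; apply: mean_le_eq => w.
by rewrite mulr_sumr; apply: eq_bigr => t _; rewrite /p mulrA [W^-1 * _]mulrC.
Qed.
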